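(* Let $H$ be a finite simple graph with maximum degree $\Delta(H)\le 2$, and let $G$ be obtained from $H$ by gluing in vertex-disjoint copies of $K_4$, i.e. there are pairwise disjoint $4$-element subsets $Y_1,\dots,Y_q\subseteq V(H)$ and $G$ has vertex set $V(H)$ and edge set $E(H)\cup\{uv: u\neq v,\ u,v\in Y_j \text{ for some } j\}$. If $H$ contains at most one odd cycle of length greater than $3$, or if $H$ contains at most $3$ triangles, then $\chi(G)\le 4$.
   Context: All graphs are finite and simple. ''Cycles of $H$'' refers to the cycle components of $H$ (since $\Delta(H)\le 2$, every component is a path or a cycle). *)

(* Defs.v *)
From mathcomp Require Import all_boot.
Set Implicit Arguments. Unset Strict Implicit. Unset Printing Implicit Defensive.

Definition simple_graph (T : finType) (e : rel T) : Prop :=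
  symmetric e /\ irreflexive e.

Definition max_deg_le (T : finType) (e : rel T) (d : nat) : Prop :=
  forall x : T, #|[set y | e x y]| <= d.

Definition component (T : finType) (e : rel T) (x : T) : {set T} :=
  [set y | connect e x y].

Definition cycle_component (T : finType) (e : rel T) (C : {set T}) : Prop :=
  (exists x, C = component e x) /\
  exists s : seq T,
    [/\ uniq s, 3 <= size s, (forall v, (v \in C) = (v \in s)) &
        forall u v, u \in C -> v \in C -> e u v = (v == next s u) || (v == prev s u)].

Definition triangles (T : finType) (e : rel T) : {set {set T}} :=
  [set S : {set T} | (#|S| == 3) && [forall x in S, forall y in S, (x != y) ==> e x y]].

Definition long_odd_cycle (T : finType) (e : rel T) (C : {set T}) : Prop :=
  [/\ cycle_component e C, odd #|C| & 3 < #|C|].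

Definition at_most_one_long_odd_cycle (T : finType) (e : rel T) : Prop :=
  forall C1 C2 : {set T}, long_odd_cycle e C1 -> long_odd_cycle e C2 -> C1 = C2.

Definition glue (T : finType) (e : rel T) (q : nat) (Y : 'I_q -> {set T}) : rel T :=
  fun u v => e u v || ((u != v) && [exists j, (u \in Y j) && (v \in Y j)]).

Definition colorable (T : finType) (g : rel T) (k : nat) : Prop :=
  exists f : T -> 'I_k, forall u v, g u v -> f u != f v.

(* Main.v *)
Require Import Defs.
From mathcomp Require Import all_boot.
From mathcomp Require Import all_order all_fingroup all_algebra all_field.
Set Implicit Arguments. Unset Strict Implicit. Unset Printing Implicit Defensive.
Import GRing.Theory.

(** Few triangles.  By Hall's theorem there is a transversal of the blocks [Y j]
    meeting every cycle inside their union; what it leaves of [H] is a linear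
    forest partitioned into triples.  Such a graph is 3-colourable (path plus
    triangles), which yields an independent transversal; one that shares as many
    vertices as possible with the Hall transversal again meets every cycle, so a
    fourth colour on it reduces the problem to path plus triangles once more.

    Path plus triangles.  Colours are the three nonzero elements of the field
    with four elements.  The sum, over the colourings rainbow on each triangle,
    of [x_0] times the product of the [x_i + x_(i+1)] along the path is [1]:
    expanding the product and summing over each triangle (a Vandermonde
    determinant) leaves the number modulo 2 of ways to delete one
    vertex of each triangle so that the two others are at positions of opposite
    parity among the remaining vertices.  These conditions are governed by a
    symmetric interlacing relation whose rows sum to zero, and a second
    expansion, over maps from triangles to triangles, cancels everything but the
    identity map.

    At most one long odd cycle.  A union of two matchings is bipartite.  With one
    matching pairing the vertices inside each block and the other a near-perfect
    matching of each component of [H], the bipartition splits each block 2-2 and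
    leaves a matching of [H] in both halves, provided that the unmatched vertex
    of an odd cycle differs in colour from one of its neighbours.  This is
    automatic in a triangle, and on the long odd cycle [C] it is achieved by
    leaving unmatched a vertex whose Kempe component misses the rest of [C],
    which exists since [C] is odd. *)

(** * Cancellation of sums in characteristic two *)

Section CharTwo.
Local Open Scope ring_scope.
Variable R : comNzRingType.
Hypothesis R2 : 2%N \in [pchar R].

Lemma sum_involution_pchar2 (X : finType) (phi : X -> X) (F : X -> R) :
  involutive phi -> (forall x, F (phi x) = F x) ->
  \sum_x F x = \sum_(x | phi x == x) F x.
Proof.
move=> phiK Fphi; rewrite (bigID (fun x => phi x == x)) /= -[RHS]addr0.
(* Each two-element orbit of [phi] contributes the same value twice; comparing ranks selects one
   element of each orbit. *)
congr (_ + _); rewrite (bigID (fun x => (enum_rank x < enum_rank (phi x))%N)) /=.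
rewrite [X in _ + X](reindex_inj (inv_inj phiK)) /=.
rewrite [X in _ + X](eq_big (fun x => (phi x != x) && (enum_rank x < enum_rank (phi x))%N) F).
- exact: (addrr_pchar2 R2).
- move=> x; rewrite phiK eq_sym; case: eqVneq => //= ne.
  rewrite -leqNgt leq_eqVlt; case: eqP => // /val_inj /enum_rank_inj ex.
  by rewrite -ex eqxx in ne.
- by move=> x _; rewrite Fphi.
Qed.

Definition ffun_upd (I A : finType) (f : {ffun I -> A}) (i : I) (a : A) : {ffun I -> A} :=
  [ffun j => if j == i then a else f j].

Lemma sum_ffun_coord0 (I A : finType) (i0 : I) (F : {ffun I -> A} -> R) :
  (forall f, \sum_a F (ffun_upd f i0 a) = 0) -> \sum_f F f = 0.
Proof.
move=> F0; case: (pickP (@predT A)) => [a0 _|A0]; last first.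
  by rewrite big1 // => f _; move: (A0 (f i0)).
(* Functions that agree off [i0] form a class, represented by its member with value [a0] at [i0];
   each class sums to zero. *)
rewrite (partition_big (fun f => ffun_upd f i0 a0) predT) //=.
rewrite big1 // => f0 _.
have [f0a|f0a] := eqVneq (f0 i0) a0; last first.
  rewrite big_pred0 // => f; apply/eqP => /ffunP /(_ i0); rewrite ffunE eqxx.
  by move=> e; rewrite e eqxx in f0a.
rewrite (reindex_onto (fun a => ffun_upd f0 i0 a) (fun f => f i0)) /=; last first.
  move=> f /eqP <-; apply/ffunP => j; rewrite !ffunE.
  by case: (eqVneq j i0) => [->|].
rewrite -[RHS](F0 f0); apply: eq_bigl => a; apply/andP; split; last first.
  by rewrite ffunE eqxx.
apply/eqP/ffunP => j; rewrite !ffunE; by case: (eqVneq j i0) => [->|].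
Qed.

(** Expanding the product over maps [g : I -> I] gives the sum of all [W g]. If [g] misses some
    [i0], summing over [f i0] kills [W g]. Permutations cancel against their inverses by symmetry,
    and an involution other than the identity has a 2-cycle, whose two equal factors merge by
    idempotence and again sum to zero. The identity contributes a power of [#|A|], which is 1. *)
Lemma sum_symmetric_interlacing (I A : finType) (r : I -> I -> A -> A -> R) :
  #|A|%:R = 1 :> R ->
  (forall i a, r i i a a = 1) ->
  (forall i j a b, i != j -> r i j a b = r j i b a) ->
  (forall i j a b, r i j a b * r i j a b = r i j a b) ->
  (forall i j b, i != j -> \sum_a r i j a b = 0) ->
  \sum_(f : {ffun I -> A}) \prod_i \sum_j r i j (f i) (f j) = 1.
Proof.
move=> cardA rii rsym ridem rsum.
pose W (g : {ffun I -> I}) := \sum_(f : {ffun I -> A}) \prod_i r i (g i) (f i) (f (g i)).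
(* Covers both cases at once: [f i0] occurs in the factor of [i0] only, or also in that of [g i0]
   when the two form a 2-cycle. *)
have vanish (g : {ffun I -> I}) i0 : g i0 != i0 ->
    (forall i, i != i0 -> g i = i0 -> g i0 = i /\ g i = i0) -> W g = 0.
  move=> gi0 gI; apply: (@sum_ffun_coord0 _ _ i0) => f.
  rewrite (eq_bigr (fun a => r i0 (g i0) a (f (g i0)) *
     \prod_(i | i != i0) (if g i == i0 then 1 else r i (g i) (f i) (f (g i))))).
    by rewrite -big_distrl /= rsum ?mul0r // eq_sym.
  move=> a _; rewrite (bigD1 i0) //= !ffunE eqxx (negbTE gi0).
  case: (pickP (fun i => (i != i0) && (g i == i0))) => [k /andP[ki0 /eqP gk]|nok].
    have [e1 _] := gI k ki0 gk.
    rewrite (bigD1 k) //= [in RHS](bigD1 k) //= !ffunE gk eqxx (negbTE ki0) mul1r.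
    rewrite e1 (rsym k i0) // mulrA ridem; congr (_ * _).
    apply: eq_bigr => i /andP[ii0 ik]; rewrite !ffunE (negbTE ii0).
    case: eqP => // gi; have [e2 _] := gI i ii0 gi.
    by rewrite -e2 e1 eqxx in ik.
  congr (_ * _); apply: eq_bigr => i ii0; rewrite !ffunE (negbTE ii0).
  by move: (nok i); rewrite ii0 /= => ->.
rewrite (eq_bigr (fun f : {ffun I -> A} => \sum_(g : {ffun I -> I})
    \prod_i r i (g i) (f i) (f (g i)))); last by move=> f _; rewrite bigA_distr_bigA.
rewrite exchange_big /= -/W (bigID (fun g : {ffun I -> I} => injectiveb g)) /=.
rewrite [X in _ + X]big1 ?addr0; last first.
  move=> g ginj.
  have [i0 i0P]: exists i0, i0 \notin codom g.
    apply/existsP; apply: contraR ginj => /existsPn gs; apply/injectiveP.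
    have: {in predT &, injective g}.
      apply/image_injP/eqP/eq_card => i; rewrite inE; apply/negPn/gs.
    by move=> ginj x y; apply: ginj.
  apply: (vanish g i0).
    by apply: contraNneq i0P => <-; apply: codom_f.
  by move=> i _ gi; rewrite -gi codom_f in i0P.
pose V (s : {perm I}) := W [ffun i => s i].
have -> : \sum_(g : {ffun I -> I} | injectiveb g) W g = \sum_(s : {perm I}) V s.
  pose in_Sn := insubd (1%g : {perm I}).
  rewrite (reindex (@pval _)) /=; last first.
    by exists in_Sn => /= f Uf; first apply: val_inj; apply: insubdK.
  apply: eq_big => [s | s _]; first exact: (valP s).
  by congr W; apply/ffunP => i; rewrite ffunE pvalE.
rewrite (@sum_involution_pchar2 _ (fun s : {perm I} => s^-1)%g) /=.
- rewrite (bigD1 1%g) /= ?invg1 ?eqxx // [X in _ + X]big1 ?addr0.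
    rewrite /V /W (eq_bigr (fun=> 1)) => [|f _].
      by rewrite sumr_const card_ffun natrX cardA expr1n.
    by rewrite big1 // => i _; rewrite ffunE perm1 rii.
  move=> s /andP[/eqP sV s1].
  have ss i : s (s i) = i by rewrite -{1}sV permK.
  have /existsP[i0 si0]: [exists i, s i != i].
    apply: contraR s1 => /existsPn si; apply/eqP/permP => i; rewrite perm1.
    by apply/eqP; move: (si i); rewrite negbK.
  apply: (vanish _ i0); rewrite ?ffunE // => i _; rewrite !ffunE => si.
  by rewrite -si ss.
- exact: invgK.
move=> s; rewrite /V /W; apply: eq_bigr => f _.
rewrite (reindex_inj (@perm_inj _ s)) /=; apply: eq_bigr => i _.
rewrite !ffunE permK; case: (eqVneq (s i) i) => [->|si]; first by [].
by rewrite rsym.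
Qed.
End CharTwo.

(** * Permutations of three points and cube roots of unity in characteristic two *)

Lemma forall_ord3 (P : pred 'I_3) :
  [forall k, P k] = [&& P ord0, P (lift ord0 ord0) & P (lift ord0 (lift ord0 ord0))].
Proof. by rewrite -(big_andE predT) !big_ord_recl big_ord0 andbT. Qed.

Lemma injectiveb_ord3 (A : eqType) (h : 'I_3 -> A) :
  injectiveb h = [&& h (lift ord0 ord0) != h ord0, h (lift ord0 (lift ord0 ord0)) != h ord0
    & h (lift ord0 (lift ord0 ord0)) != h (lift ord0 ord0)].
Proof.
have -> : injectiveb h = [forall i, [forall j, (h i == h j) ==> (i == j)]].
  apply/injectiveP/forallP => [hi i | hi i j /eqP e].
    by apply/forallP => j; apply/implyP => /eqP /hi ->.
  by have /forallP /(_ j) /implyP /(_ e) /eqP := hi i.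
rewrite forall_ord3 !forall_ord3 /= !implybT !andbT /= !implybF.
rewrite ![h ord0 == _]eq_sym [h (lift ord0 ord0) == h (lift _ (lift _ _))]eq_sym.
by do 3!case: (_ == _).
Qed.

Section CubeRoot.
Local Open Scope ring_scope.
Variables (F : fieldType) (w : F).
Hypotheses (F2 : 2%N \in [pchar F]) (w_root : w ^+ 2 + w + 1 = 0).

Lemma cube_root_sqr : w ^+ 2 = 1 + w.
Proof.
by apply/eqP; rewrite -subr_eq0 (oppr_pchar2 F2) addrA [_ + 1 + w]addrAC w_root.
Qed.

Lemma cube_root_cube : w * w ^+ 2 = 1.
Proof.
by rewrite cube_root_sqr mulrDr mulr1 -expr2 cube_root_sqr addrCA (addrr_pchar2 F2) addr0.
Qed.

(** Signs disappear in characteristic two, so the sum is a Vandermonde determinant with nodes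
    [w ^+ h k]. Three distinct nodes are [1], [w], [w ^+ 2], whose pairwise sums are again these
    three elements and have product 1. *)
Lemma sum_perm3_cube_root (h : 'I_3 -> nat) :
  (forall k, h k <= 2)%N ->
  \sum_(s : 'S_3) \prod_k w ^+ (s k * h k) = (injectiveb h)%:R.
Proof.
move=> h2; pose a : 'rV[F]_3 := \row_k w ^+ h k.
have -> : \sum_(s : 'S_3) \prod_k w ^+ (s k * h k) = \det (Vandermonde 3 a).
  rewrite -det_tr; apply: eq_bigr => s _; rewrite (oppr_pchar2 F2) expr1n mul1r.
  by apply: eq_bigr => k _; rewrite !mxE -exprM mulnC.
rewrite det_Vandermonde.
have -> : \prod_(i < 3) \prod_(j < 3 | (i < j)%N) (a 0 j - a 0 i) =
    (w ^+ h (lift 0 0) + w ^+ h 0) * (w ^+ h (lift 0 (lift 0 0)) + w ^+ h 0)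
    * (w ^+ h (lift 0 (lift 0 0)) + w ^+ h (lift 0 0)).
  rewrite !big_ord_recl big_ord0 /=.
  under eq_bigr do rewrite !(oppr_pchar2 F2) !mxE.
  rewrite [X in X * _]big_mkcond [X in _ * (X * _)]big_mkcond [X in _ * (_ * (X * _))]big_mkcond.
  by rewrite !big_ord_recl !big_ord0 /= !mul1r !mulr1 !(oppr_pchar2 F2) !mxE.
rewrite injectiveb_ord3.
have w2 := cube_root_sqr; have w3 := cube_root_cube.
have s01 : 1 + w = w ^+ 2 by [].
have s02 : 1 + w ^+ 2 = w by rewrite w2 addrA (addrr_pchar2 F2) add0r.
have s12 : w + w ^+ 2 = 1 by rewrite w2 addrCA (addrr_pchar2 F2) addr0.
have s10 : w + 1 = w ^+ 2 by rewrite addrC.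
have s20 : w ^+ 2 + 1 = w by rewrite addrC.
have s21 : w ^+ 2 + w = 1 by rewrite addrC.
have w3' : w ^+ 2 * w = 1 by rewrite mulrC.
move: (h2 0) (h2 (lift 0 0)) (h2 (lift 0 (lift 0 0))).
case: (h 0) => [|[|[|//]]] _; case: (h (lift 0 0)) => [|[|[|//]]] _;
  case: (h (lift 0 (lift 0 0))) => [|[|[|//]]] _ /=;
  rewrite ?expr0 ?expr1 ?(addrr_pchar2 F2) ?mul0r ?mulr0 ?mul0r //
    ?s01 ?s02 ?s12 ?s10 ?s20 ?s21 ?mulr1 ?mul1r ?w3 ?w3' //.
Qed.
End CubeRoot.

(** * Expanding the product of neighbouring sums along the path *)

Section PathPlusTriangles.
Local Open Scope ring_scope.

(** The value 0 before the start turns the first factor [y i + prev_term y i] into [y 0]. *)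
Definition prev_term (R : nmodType) (y : nat -> R) (i : nat) : R :=
  if i is j.+1 then y j else 0.

(** [D i] records that factor [i] chooses [y i]. Hence [y i] is chosen by its own factor if [D i]
    holds and by the next one if [D i.+1] fails; factor 0 has no other nonzero choice. The extra
    factor on the left is what factor [m] adds to the exponent of [y m.-1], as the induction
    requires. *)
Lemma prod_select_prev (R : comNzRingType) (D : nat -> bool) (y : nat -> R) m :
  (\prod_(i < m) (if D i then y i else prev_term y i)) * (if D m then 1 else prev_term y m)
  = (D 0%N)%:R * \prod_(i < m) y i ^+ (D i + ~~ D i.+1).
Proof.
elim: m => [|m IH]; first by rewrite !big_ord0 mul1r mulr1; case: (D 0%N).
rewrite !big_ord_recr /= mulrA -IH -!mulrA; congr (_ * _).
by case: (D m); case: (D m.+1); rewrite /= ?expr1 ?expr0 ?mul1r ?mulr1 // mulrC.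
Qed.

(** Past the end the value is [true], since no later factor can choose the last [y i]. *)
Definition ext_true m (d : {ffun 'I_m -> bool}) (i : nat) : bool :=
  if insub i is Some j then d j else true.

Lemma ext_true_ord m (d : {ffun 'I_m -> bool}) (i : 'I_m) : ext_true d i = d i.
Proof. by rewrite /ext_true valK. Qed.

Lemma ext_true_max m (d : {ffun 'I_m -> bool}) : ext_true d m = true.
Proof. by rewrite /ext_true insubF // ltnn. Qed.

Lemma prod_add_prev (R : comNzRingType) (y : nat -> R) m :
  \prod_(i < m) (y i + prev_term y i) =
  \sum_(d : {ffun 'I_m -> bool})
    (ext_true d 0)%:R * \prod_(i < m) y i ^+ (ext_true d i + ~~ ext_true d i.+1).
Proof.
under eq_bigr => i _.
  rewrite (_ : _ + _ = \sum_(b : bool) (if b then y i else prev_term y i)); last first.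
    by rewrite big_bool.
  over.
rewrite bigA_distr_bigA; apply: eq_bigr => d _ /=.
rewrite -prod_select_prev ext_true_max mulr1.
by apply: eq_bigr => i _; rewrite ext_true_ord.
Qed.

Lemma natr_odd_pchar2 (R : nzRingType) (n : nat) :
  2%N \in [pchar R] -> (odd n)%:R = n%:R :> R.
Proof.
move=> R2; rewrite -[in RHS](odd_double_half n) natrD -addnn natrD.
by rewrite (addrr_pchar2 R2) addr0.
Qed.

(* The exponent [u + ~~ v] is [1] when [u = v]; otherwise it is [2] or [0]
   according to [u]. *)
Lemma injectiveb_exponents (u v : 'I_3 -> bool) :
  nat_of_bool (injectiveb (fun k => u k + ~~ v k)%N) =
  (\sum_(a < 3) ([forall k, (u k == v k) == (k == a)] && odd (\sum_(k | k != a) u k)))%N.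
Proof.
rewrite injectiveb_ord3.
under eq_bigr do rewrite forall_ord3 big_mkcond /= !big_ord_recl big_ord0.
rewrite !big_ord_recl big_ord0 /=.
move: (u _) (u _) (u _) (v _) (v _) (v _).
by do 6!case.
Qed.

End PathPlusTriangles.

(** * Parities of kept vertices and interlacing of triangles *)

Section TriangleParity.
Local Open Scope ring_scope.
Variables (I : finType) (h : seq (I * 'I_3)).
Hypotheses (h_uniq : uniq h) (h_full : forall v, v \in h).

Let pos (t : I) (k : 'I_3) : nat := index (t, k) h.

Lemma pos_inj t k t' k' : pos t k = pos t' k' -> (t, k) = (t', k').
Proof. by move=> /index_inj; apply. Qed.

(** With vertex [a] deleted from [t] and [b] from [s], the parity of this number tells, for
    [t != s], whether the two remaining pairs interlace on the path. *)
Definition precedences (t s : I) (a b : 'I_3) : nat :=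
  (\sum_(k | k != a) \sum_(l | l != b) (pos s l < pos t k))%N.

Lemma precedences_diag t a : precedences t t a a = 1%N.
Proof.
have cmp k l : k != l -> ((pos t k < pos t l) + (pos t l < pos t k) = 1)%N.
  by move=> kl; case: ltngtP => // /pos_inj [ekl]; rewrite ekl eqxx in kl.
rewrite /precedences.
under eq_bigr do rewrite big_mkcond !big_ord_recl big_ord0 /=.
rewrite big_mkcond !big_ord_recl big_ord0 /= !ltnn.
have c01 := cmp ord0 (lift ord0 ord0) isT.
have c02 := cmp ord0 (lift ord0 (lift ord0 ord0)) isT.
have c12 := cmp (lift ord0 ord0) (lift ord0 (lift ord0 ord0)) isT.
case: a => [[|[|[|//]]] ap] /=; rewrite ?addn0 ?add0n //; rewrite addnC //.
Qed.

Lemma card_neq_ord3 (a : 'I_3) : #|[pred k | k != a]| = 2.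
Proof. by have := cardC1 a; rewrite card_ord. Qed.

(** Each of the four pairs of remaining vertices is counted in exactly one summand; as 4 is even,
    the two parities agree. *)
Lemma precedences_sym t s a b : t != s ->
  (precedences t s a b + precedences s t b a = 4)%N.
Proof.
move=> ts; rewrite /precedences [in X in (_ + X)%N]exchange_big -big_split /=.
rewrite (eq_bigr (fun=> 2)) ?sum_nat_const ?card_neq_ord3 // => k _.
rewrite -big_split /= (eq_bigr (fun=> 1%N)) ?sum_nat_const ?card_neq_ord3 // => l _.
by case: ltngtP => // /pos_inj [est _]; rewrite est eqxx in ts.
Qed.

(** Every vertex [k] of [t] survives two of the three deletions. The sum is therefore even, which
    makes the interlacing relation sum to zero. *)
Lemma precedences_sum t s b :
  (\sum_a precedences t s a b = \sum_k (\sum_(l | l != b) (pos s l < pos t k)) * 2)%N.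
Proof.
rewrite /precedences (exchange_big_dep predT) //=; apply: eq_bigr => k _.
rewrite sum_nat_const [LHS]mulnC; congr (_ * _)%N.
by rewrite -[RHS](card_neq_ord3 k); apply: eq_card => a; rewrite !inE eq_sym.
Qed.

Definition kept (f : {ffun I -> 'I_3}) (v : I * 'I_3) : bool := v.2 != f v.1.

(** The only choice [d] of factors compatible with the deletions [f]: it starts with [true] and
    changes exactly across kept vertices. *)
Definition kept_parity (f : {ffun I -> 'I_3}) (i : nat) : bool :=
  ~~ odd (count (kept f) (take i h)).

Lemma count_kept f i :
  count (kept f) (take i h) = (\sum_t \sum_(k | k != f t) (pos t k < i))%N.
Proof.
rewrite pair_big_dep /= -size_filter.
rewrite -(card_uniqP _) ?filter_uniq ?take_uniq // -sum1_card.
rewrite [RHS]big_mkcond [LHS]big_mkcond /=; apply: eq_bigr => -[t k] _ /=.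
rewrite mem_filter in_take // /kept /=.
by case: (k != f t) => //=; case: ltnP.
Qed.

Lemma count_kept_all f : count (kept f) h = (#|I| * 2)%N.
Proof.
rewrite -{1}(take_size h) count_kept -sum_nat_const; apply: eq_bigr => t _.
rewrite (eq_bigr (fun=> 1%N)) ?sum_nat_const ?card_neq_ord3 // => k _.
by rewrite /pos index_mem h_full.
Qed.

(** The two negations cancel modulo 2, leaving the numbers of kept vertices before each of the two
    kept vertices of [t]; sorted by triangle, these are the [precedences]. *)
Lemma odd_kept_parity (R : comNzRingType) (f : {ffun I -> 'I_3}) t :
  2%N \in [pchar R] ->
  (odd (\sum_(k | k != f t) kept_parity f (pos t k)))%:R =
  \sum_s (precedences t s (f t) (f s))%:R :> R.
Proof.
move=> R2; rewrite natr_odd_pchar2 // -natr_sum.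
have -> : (\sum_s precedences t s (f t) (f s) =
    \sum_(k | k != f t) count (kept f) (take (pos t k) h))%N.
  by rewrite /precedences exchange_big; apply: eq_bigr => k _; rewrite count_kept.
rewrite !natr_sum.
rewrite (eq_bigr (fun k => 1 + (count (kept f) (take (pos t k) h))%:R)).
  rewrite big_split /= sumr_const card_neq_ord3 mulr2n (addrr_pchar2 R2).
  by rewrite add0r.
move=> k _; rewrite /kept_parity -[X in _ = _ + X]natr_odd_pchar2 //.
by case: (odd _); rewrite /= ?mulr0n ?mulr1n ?addr0 ?(addrr_pchar2 R2).
Qed.

Lemma ext_true_unique (f : {ffun I -> 'I_3}) (d : {ffun 'I_(size h) -> bool}) :
  ext_true d 0 ->
  (forall t k, (ext_true d (pos t k) == ext_true d (pos t k).+1) = (k == f t)) ->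
  d = [ffun i : 'I_(size h) => kept_parity f i].
Proof.
move=> d0 dS; apply/ffunP => i; rewrite ffunE -ext_true_ord.
move: (nat_of_ord i) (ltn_ord i) => {i} i; elim: i => [|i IH] hi.
  by rewrite d0 /kept_parity take0.
have {}IH := IH (ltnW hi).
have [x0 _] : exists x0, x0 \in h.
  by move: hi; case: (h) => // x0 h' _; exists x0; rewrite mem_head.
have [t [k e]]: exists t, exists k, nth x0 h i = (t, k).
  by case: (nth x0 h i) => t k; exists t, k.
have ei : pos t k = i by rewrite /pos -e index_uniq // ltnW.
have := dS t k; rewrite ei IH /kept_parity (take_nth x0) ?(ltnW hi) //.
rewrite -cats1 count_cat /= addn0 e /kept /= oddD => <-.
by case: (odd _); case: (ext_true d i.+1).
Qed.

(** The position past the end also agrees, because the total number of kept vertices is even. *)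
Lemma kept_parity_ext (f : {ffun I -> 'I_3}) i : (i <= size h)%N ->
  ext_true [ffun i : 'I_(size h) => kept_parity f i] i = kept_parity f i.
Proof.
rewrite leq_eqVlt => /orP[/eqP->|hi].
  by rewrite ext_true_max /kept_parity take_size count_kept_all oddM andbF.
by rewrite -[i]/(nat_of_ord (Ordinal hi)) ext_true_ord ffunE.
Qed.

Lemma kept_parity_step (f : {ffun I -> 'I_3}) t k :
  (kept_parity f (pos t k) == kept_parity f (pos t k).+1) = (k == f t).
Proof.
have hi : (pos t k < size h)%N by rewrite index_mem h_full.
rewrite /kept_parity (take_nth (t, k)) // -cats1 count_cat /= addn0.
rewrite nth_index // oddD /kept /= oddb.
by case: (odd _); case: (k == f t).
Qed.

(** Expanding each factor by [injectiveb_exponents] brings in a choice [f] of one deleted vertex per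
    triangle. Given [f], a single [d] survives, and its term is a product of row sums of
    [precedences], to which [sum_symmetric_interlacing] applies. *)
Lemma sum_injective_exponents (R : comNzRingType) : 2%N \in [pchar R] ->
  \sum_(d : {ffun 'I_(size h) -> bool}) (ext_true d 0)%:R *
    \prod_t (injectiveb (fun k => ext_true d (pos t k) + ~~ ext_true d (pos t k).+1)%N)%:R
  = 1 :> R.
Proof.
move=> R2.
pose C (d : {ffun 'I_(size h) -> bool}) (f : {ffun I -> 'I_3}) t k :=
  (ext_true d (pos t k) == ext_true d (pos t k).+1) == (k == f t).
pose P (d : {ffun 'I_(size h) -> bool}) (f : {ffun I -> 'I_3}) t :=
  [forall k, C d f t k] && odd (\sum_(k | k != f t) ext_true d (pos t k)).
transitivity (\sum_(d : {ffun 'I_(size h) -> bool}) \sum_(f : {ffun I -> 'I_3})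
    (ext_true d 0)%:R * \prod_t (P d f t)%:R : R).
  apply: eq_bigr => d _; rewrite -big_distrr /=; congr (_ * _).
  under eq_bigr do rewrite injectiveb_exponents natr_sum.
  by rewrite bigA_distr_bigA.
rewrite exchange_big /=.
transitivity (\sum_(f : {ffun I -> 'I_3}) \prod_t
    \sum_s (precedences t s (f t) (f s))%:R : R).
  apply: eq_bigr => f _.
  rewrite (bigD1 [ffun i : 'I_(size h) => kept_parity f i]) //=.
  rewrite [X in _ + X]big1 ?addr0; last first.
    move=> d; apply: contraNeq => nz.
    apply/eqP/ext_true_unique; first by apply: contraNT nz => /negbTE->; rewrite mul0r.
    move=> t k; apply: contraNeq nz => nC.
    rewrite (bigD1 t) //= (_ : P d f t = false) ?mul0r ?mulr0 //.
    by apply/negbTE; rewrite negb_and; apply/orP; left; apply/forallPn; exists k.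
  rewrite kept_parity_ext // /kept_parity take0 mul1r.
  apply: eq_bigr => t _; rewrite -odd_kept_parity //; congr (_%:R).
  have lt k : (pos t k < size h)%N by rewrite index_mem h_full.
  rewrite /P (_ : [forall k, _]); last first.
    by apply/forallP => k; rewrite /C !kept_parity_ext ?lt ?(ltnW (lt k)) // kept_parity_step.
  by congr (nat_of_bool (odd _)); apply: eq_bigr => k _; rewrite kept_parity_ext ?(ltnW (lt k)).
have nat_idem n : n%:R * n%:R = n%:R :> R.
  by rewrite -natr_odd_pchar2 //; case: (odd n); rewrite ?mulr1 ?mulr0.
apply: (@sum_symmetric_interlacing R R2 _ _ (fun t s a b => (precedences t s a b)%:R)) => //.
- by rewrite card_ord -natr_odd_pchar2.
- by move=> t a; rewrite precedences_diag.
- move=> t s a b ts; apply/eqP; rewrite -subr_eq0 (oppr_pchar2 R2) -natrD.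
  by rewrite precedences_sym // -natr_odd_pchar2.
- move=> t s b _; rewrite -natr_sum precedences_sum -big_distrl /= -natr_odd_pchar2 //.
  by rewrite oddM andbF.
Qed.

End TriangleParity.

(** * Three-colouring a path plus triangles *)

Section PathPlusTrianglesTheorem.
Local Open Scope ring_scope.

(** Any element of the field of order 4 other than 0 and 1 will do: [w ^+ 4 = w] gives
    [w * (w - 1) * (w ^+ 2 + w + 1) = 0]. *)
Lemma exists_cube_root_pchar2 :
  exists (F : fieldType) (w : F), 2%N \in [pchar F] /\ w ^+ 2 + w + 1 = 0.
Proof.
have [F F2 cardF] := @pPrimePowerField 2 2 isT isT.
have [w]: exists w : F, w \notin [set (0 : F); 1].
  apply/existsP; apply: contraTT isT => /existsPn F01.
  have: (#|F| <= #|[set 0%R; 1%R : F]|)%N.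
    by apply/subset_leq_card/subsetP => w _; apply/negPn/F01.
  by rewrite cardF cards2; case: (_ != _).
rewrite !inE negb_or => /andP[w0 w1]; exists F, w; split=> //.
have w4 : w ^+ 4 = w by rewrite -[RHS]expf_card cardF.
have /eqP : w * ((w - 1) * (w ^+ 2 + w + 1)) = 0.
  have -> : (w - 1) * (w ^+ 2 + w + 1) = w ^+ 3 - 1.
    rewrite subrX1 !big_ord_recr big_ord0 /= expr0 expr1 add0r.
    by rewrite [1 + w]addrC addrC [w ^+ 2 + _]addrC [_ + w ^+ 2]addrC addrA.
  by rewrite mulrBr mulr1 -exprS w4 subrr.
by rewrite !mulf_eq0 (negbTE w0) subr_eq0 (negbTE w1) => /eqP.
Qed.

(** The list [h] is the path, and [(t, k)] is vertex [k] of triangle [t]. A colouring rainbow on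
    each triangle is a family of permutations [phi t], with [w ^+ c] standing for colour [c]. Equal
    neighbouring colours make [Q phi] vanish, so a nonzero [Q phi] suffices. *)
Theorem path_plus_triangles (I : finType) (h : seq (I * 'I_3)) :
  uniq h -> (forall v, v \in h) ->
  exists phi : {ffun I -> 'S_3}, sorted (fun u v => phi u.1 u.2 != phi v.1 v.2) h.
Proof.
move=> h_uniq h_full.
have [F [w [F2 w_root]]] := exists_cube_root_pchar2.
case: (posnP (size h)) => [/eqP/nilP->|]; first by exists [ffun=> 1%g].
case: {1}h => // x0 _ _.
pose x (phi : {ffun I -> 'S_3}) (v : I * 'I_3) : F := w ^+ phi v.1 v.2.
pose y phi i := x phi (nth x0 h i).
pose Q phi := \prod_(i < size h) (y phi i + prev_term (y phi) i).
have sumQ : \sum_phi Q phi = 1.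
  rewrite /Q; under eq_bigr do rewrite prod_add_prev.
  rewrite exchange_big /= -[RHS](sum_injective_exponents h_uniq h_full F2).
  apply: eq_bigr => d _; rewrite -big_distrr /=; congr (_ * _).
  under [RHS]eq_bigr => t _.
    rewrite -(sum_perm3_cube_root F2 w_root); last first.
      by move=> k; case: (ext_true _ _); case: (ext_true _ _).
    over.
  rewrite bigA_distr_bigA; apply: eq_bigr => phi _ /=.
  rewrite pair_big /= -(big_mkord predT (fun i =>
    y phi i ^+ (ext_true d i + ~~ ext_true d i.+1))).
  transitivity (\prod_(v <- h) x phi v ^+
     (ext_true d (index v h) + ~~ ext_true d (index v h).+1)).
    rewrite (big_nth x0) !big_nat; apply: eq_bigr => i /andP[_ hi].
    by rewrite index_uniq.
  rewrite big_uniq //=; apply: eq_big => [v|[t k] _]; first by rewrite h_full.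
  by rewrite /x /= -exprM.
have [phi Qphi] : exists phi, Q phi != 0.
  apply/existsP; apply: contraT => /existsPn Q0.
  suff: \sum_phi Q phi = 0 by rewrite sumQ => /eqP; rewrite oner_eq0.
  by apply: big1 => phi _; apply/eqP; move: (Q0 phi); rewrite negbK.
exists phi; apply/(sortedP x0) => i hi.
apply: contraNneq Qphi => e; rewrite /Q (bigD1 (Ordinal hi)) //=.
by rewrite /y /x e (addrr_pchar2 F2) mul0r.
Qed.

End PathPlusTrianglesTheorem.

(** * Two-colouring the union of two involutions *)

Section TwoInvolutions.
Variables (T : finType) (mu nu : T -> T).
Hypotheses (muK : involutive mu) (nuK : involutive nu).

Let rho x := mu (nu x).

Lemma rho_inj : injective rho.
Proof. by move=> x y /(inv_inj muK) /(inv_inj nuK). Qed.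

Lemma rho_connect_sym : connect_sym (frel rho).
Proof. exact: fconnect_sym rho_inj. Qed.

(** [mu] conjugates [rho] to its inverse, so when it fixes [x] it sends [rho^n x] to
    [rho^(-n) x]. *)
Lemma iter_rho_fixed x n : mu x = x -> iter n rho (mu (iter n rho x)) = x.
Proof.
move=> mux; elim: n => [|n IH] //.
have mu_rho w : mu (rho w) = nu w by rewrite /rho muK.
have rho_nu w : rho (nu w) = mu w by rewrite /rho nuK.
by rewrite [iter n.+1 rho x]iterS mu_rho iterSr rho_nu.
Qed.

Lemma fconnect_mu x z : mu x = x -> fconnect rho x z -> fconnect rho x (mu z).
Proof.
move=> mux /iter_findex <-; set n := findex _ _ _.
by rewrite rho_connect_sym -{2}(iter_rho_fixed n mux) fconnect_iter.
Qed.

Lemma fconnect_nu x z : mu x = x -> fconnect rho x z -> fconnect rho x (nu z).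
Proof.
move=> mux xz; rewrite -[nu z]muK; apply: fconnect_mu => //.
exact: connect_trans xz (fconnect1 _ _).
Qed.

(* On a [rho]-cycle through a fixed point of [mu], the involution [mu] acts as
   a reflection, and a reflection of a cycle has at most two fixed points. *)
Lemma fixed_points_le2 x y z : mu x = x -> mu y = y -> mu z = z ->
  fconnect rho x y -> fconnect rho x z -> y != x -> z != x -> y = z.
Proof.
move=> mux.
(* Such a [u] lies opposite [x] on the [rho]-cycle, which determines it. *)
suff half u : mu u = u -> fconnect rho x u -> u != x -> (findex rho x u).*2 = fingraph.order rho x.
  move=> muy muz xy xz yx zx; rewrite -(iter_findex xy) -(iter_findex xz).
  by congr (iter _ _ _); apply: double_inj; rewrite !half.
move=> muu xu ux; set k := findex rho x u.
have ku : iter k rho x = u by apply: iter_findex.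
have kL : k < fingraph.order rho x by apply: findex_max.
have k0 : 0 < k by rewrite lt0n; apply: contraNneq ux => k0; rewrite -ku k0.
have k2 : iter k.*2 rho x = x by rewrite -addnn iterD ku -{1}muu -ku iter_rho_fixed.
case: (ltnP k.*2 (fingraph.order rho x)) => kk.
  by have := findex_iter kk; rewrite k2 findex0 => /esym /eqP; rewrite double_eq0 eqn0Ngt k0.
apply/eqP; rewrite eqn_leq kk andbT leqNgt; apply/negP => lt.
have dL : k.*2 - fingraph.order rho x < fingraph.order rho x.
  by rewrite ltn_subLR // addnn ltn_double.
have: iter (k.*2 - fingraph.order rho x) rho x = x.
  by rewrite -[RHS]k2 -[in RHS](subnK kk) iterD (iter_order rho_inj).
move=> e; have := findex_iter dL; rewrite e findex0 => /esym /eqP.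
by rewrite subn_eq0 leqNgt lt.
Qed.

(** No [x] shares its [rho]-orbit with [nu x], whereas [mu x] and [nu x] share one. The orbits thus
    come in pairs, and the colour selects one orbit of each pair by the rank of its root. *)
Lemma involutions_bipartite_free :
  (forall x, mu x != x) -> (forall x, nu x != x) ->
  exists c : T -> bool, forall x, c (mu x) != c x /\ c (nu x) != c x.
Proof.
move=> mufree nufree.
(* From [nu x = rho^n x] follows [nu (rho x) = rho^(n-2) (rho x)], a descent that ends at a fixed
   point of [nu] or [mu]. *)
have nc x : ~~ fconnect rho x (nu x).
  apply/negP => /iter_findex; move: (findex _ _ _) => n.
  have [m] := ubnP n; elim: m n x => // m IH [|[|n]] x nm.
  - by move=> /= e; have := nufree x; rewrite -e eqxx.
  - by move=> /= e; have := mufree (nu x); rewrite -/(rho x) e eqxx.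
  rewrite iterSr iterS => e; apply: (IH n (rho x)); first by apply: ltnW; rewrite -ltnS.
  by rewrite -[LHS]nuK; congr nu; rewrite -[LHS]muK -/(rho _) e.
pose rt := froot rho.
have rtmu x : rt (mu x) = rt (nu x).
  apply/eqP; rewrite /rt (root_connect rho_connect_sym) rho_connect_sym.
  by rewrite -{2}(nuK x) fconnect1.
have rtnu x : rt (nu x) != rt x.
  by rewrite /rt (root_connect rho_connect_sym) rho_connect_sym.
exists (fun x => enum_rank (rt x) < enum_rank (rt (nu x))) => x.
have key : enum_rank (rt x) != enum_rank (rt (nu x)) :> nat.
  by apply: contra (rtnu x) => /eqP/val_inj/enum_rank_inj->.
have e : rt (nu (mu x)) = rt x by rewrite -rtmu muK.
rewrite rtmu e nuK; split; by move: key; case: ltngtP.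
Qed.

End TwoInvolutions.

Lemma involutions_bipartite (T : finType) (mu nu : T -> T) :
  involutive mu -> involutive nu ->
  exists c : T -> bool, forall x,
    (mu x != x -> c (mu x) != c x) /\ (nu x != x -> c (nu x) != c x).
Proof.
move=> muK nuK.
(* On two copies of [T] a fixed point is exchanged with its copy, so that no fixed points remain. *)
pose dbl (f : T -> T) (p : T * bool) := if f p.1 != p.1 then (f p.1, p.2) else (p.1, ~~ p.2).
have dblK f : involutive f -> involutive (dbl f).
  move=> fK [x b]; rewrite /dbl /=; have [/= fx|/= fx] := eqVneq (f x) x.
    by rewrite fx eqxx /= negbK.
  by rewrite fK eq_sym fx.
have dblN f p : dbl f p != p.
  case: p => x b; rewrite /dbl /=; case: (eqVneq (f x) x) => fx /=.
    by rewrite xpair_eqE eqxx; case: b.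
  by rewrite xpair_eqE (negbTE fx).
have [c cP] := involutions_bipartite_free (dblK _ muK) (dblK _ nuK) (dblN mu) (dblN nu).
exists (fun x => c (x, true)) => x; have [cm cn] := cP (x, true).
by split=> fx; [move: cm | move: cn]; rewrite /dbl /= fx.
Qed.

(** The two colours may be exchanged on a set closed under both involutions without creating a
    conflict. *)
Lemma involutions_bipartite_separate (T : finType) (mu nu : T -> T) (K : {pred T}) (y u : T) :
  involutive mu -> involutive nu ->
  (forall x, (mu x \in K) = (x \in K)) -> (forall x, (nu x \in K) = (x \in K)) ->
  y \in K -> u \notin K ->
  exists c : T -> bool, (forall x,
    (mu x != x -> c (mu x) != c x) /\ (nu x != x -> c (nu x) != c x)) /\ c y != c u.
Proof.
move=> muK nuK Kmu Knu yK uK; have [c cP] := involutions_bipartite muK nuK.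
exists (fun x => c x (+) ((x \in K) && (c y == c u))); split; last first.
  by rewrite yK (negbTE uK); case: (c y); case: (c u).
move=> x; have [cm cn] := cP x; rewrite Kmu Knu.
split=> fx; [have {cm cn} := cm fx | have {cm cn} := cn fx];
  by case: (c _); case: (c x); case: (_ && _).
Qed.

Lemma card_involution_even (T : finType) (A : {set T}) (f : T -> T) :
  (forall x, x \in A -> f x \in A) -> (forall x, x \in A -> f (f x) = x) ->
  (forall x, x \in A -> f x != x) -> ~~ odd #|A|.
Proof.
move=> fA fK fN.
pose B := [set x in A | enum_rank x < enum_rank (f x)].
have cmp x : x \in A -> (enum_rank (f x) < enum_rank x) = ~~ (enum_rank x < enum_rank (f x)).
  move=> xA; case: ltngtP => // /val_inj/enum_rank_inj e.
  by have := fN x xA; rewrite {1}e eqxx.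
have fB : f @: B = A :\: B.
  apply/setP => z; rewrite !inE; apply/imsetP/idP.
    case=> x; rewrite inE => /andP[xA lt] ->.
    by rewrite fA // fK // cmp // lt.
  case/andP; rewrite negb_and => + zA; rewrite zA /= => lt.
  by exists (f z); rewrite ?inE ?fA ?fK //= cmp.
have finj : {in B &, injective f}.
  move=> x y; rewrite !inE => /andP[xA _] /andP[yA _] e.
  by rewrite -(fK x xA) e fK.
rewrite -(cardsID B A) (setIidPr _); last by apply/subsetP => x; rewrite inE => /andP[].
by rewrite -fB card_in_imset // addnn odd_double.
Qed.

(** * Pairing neighbouring entries of a sequence *)

Definition partner_index (i : nat) : nat := if odd i then i.-1 else i.+1.

Lemma partner_indexK : involutive partner_index.
Proof. by case=> [|i] //; rewrite /partner_index /=; case E: (odd i); rewrite /= E. Qed.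

Lemma partner_index_neq i : partner_index i != i.
Proof.
rewrite /partner_index; case: ifP => [|_]; last by rewrite neq_ltn ltnSn orbT.
by case: i => // i _; rewrite neq_ltn /= ltnSn.
Qed.

Section SeqPartition.
Variable T : eqType.
Implicit Types (S : T -> seq T).

(** A partition of [T] with an order on each class, given by the class of each element; the order
    decides who is paired with whom. *)
Definition seq_partition S :=
  forall x, [/\ uniq (S x), x \in S x & forall y, y \in S x -> S y = S x].

(* When the partner index is out of range, [nth] returns its default [x]. *)
Definition partner S x := nth x (S x) (partner_index (index x (S x))).

Lemma partner_mem S x : seq_partition S -> partner S x \in S x.
Proof.
move=> SP; have [_ xS _] := SP x; rewrite /partner.
by case: (ltnP (partner_index (index x (S x))) (size (S x))) => h;
  [apply: mem_nth | rewrite nth_default].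
Qed.

Lemma index_partner S x : seq_partition S ->
  partner_index (index x (S x)) < size (S x) ->
  index (partner S x) (S x) = partner_index (index x (S x)).
Proof. by move=> SP h; have [u _ _] := SP x; rewrite index_uniq. Qed.

Lemma partnerK S : seq_partition S -> involutive (partner S).
Proof.
move=> SP x; have [u xS Sx] := SP x.
case: (ltnP (partner_index (index x (S x))) (size (S x))) => h; last first.
  by have e : partner S x = x; rewrite {1}/partner ?nth_default // e.
rewrite {1}/partner (Sx _ (partner_mem x SP)) index_partner // partner_indexK.
by rewrite nth_index.
Qed.

Lemma partner_neq S x : seq_partition S ->
  partner_index (index x (S x)) < size (S x) -> partner S x != x.
Proof.
move=> SP h; apply: contraNneq (partner_index_neq (index x (S x))) => e.
by rewrite -index_partner // e.
Qed.

End SeqPartition.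

(** * Components of graphs of maximum degree two *)

Section DegreeTwo.
Variables (T : finType) (e : rel T).
Hypotheses (e_sym : symmetric e) (e_irr : irreflexive e) (e_deg : max_deg_le e 2).

Lemma third_neighbor x a b v : e x a -> e x b -> a != b -> e x v -> v = a \/ v = b.
Proof.
move=> xa xb ab xv; have [->|va] := eqVneq v a; [by left|right].
apply/eqP; apply: contraTT (e_deg x) => vb; rewrite -ltnNge.
have: #|[set v; a; b]| <= #|[set y | e x y]|.
  by apply/subset_leq_card/subsetP => z; rewrite !inE => /orP[/orP[]|] /eqP->.
by rewrite -setUA cardsU1 cards2 !inE negb_or va vb ab.
Qed.

Definition consecutive (s : seq T) (u v : T) : bool :=
  (index v s == (index u s).+1) || (index u s == (index v s).+1).

Definition wraps (s : seq T) (u v : T) : bool :=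
  (index u s == 0) && (index v s == (size s).-1) ||
  (index v s == 0) && (index u s == (size s).-1).

(** Closure under adjacency makes a nonempty [s] a whole component; [wraps] allows for the closing
    edge of a cycle. *)
Definition component_enum (s : seq T) : Prop :=
  [/\ uniq s, sorted e s &
      forall u v, u \in s -> e u v -> v \in s /\ (consecutive s u v || wraps s u v)].

Lemma sorted_consecutive x s i : sorted e s -> i.+1 < size s -> e (nth x s i) (nth x s i.+1).
Proof. by move=> /(sortedP x) h; apply: h. Qed.

(** A longest path through [x] works: an inner vertex already has two neighbours on the path, and a
    neighbour of an end that lay outside would extend it. *)
Lemma exists_component_enum x : exists s, x \in s /\ component_enum s.
Proof.
pose P n := [exists t : n.-tuple T, [&& x \in tval t, uniq t & sorted e t]].
have P1 : exists n, P n.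
  by exists 1; apply/existsP; exists [tuple x]; rewrite /= mem_head.
have Pmax n : P n -> n <= #|T|.
  case/existsP => t /and3P[_ tu _]; rewrite -(size_tuple t).
  by rewrite -(card_uniqP tu) max_card.
case: (ex_maxnP P1 Pmax) => n /existsP[t /and3P[xt tu ts]] tmax.
have longer s : x \in s -> uniq s -> sorted e s -> size s <= size t.
  move=> xs su ss; rewrite size_tuple; apply: tmax; apply/existsP.
  by exists (in_tuple s); rewrite xs su ss.
move: (tval t) xt tu ts longer => {n t tmax} s xs su ss smax.
exists s; split=> //; split=> // u v us uv.
have idx_lt w : (w \in s) = (index w s < size s) by rewrite index_mem.
have inner w z : w \in s -> e w z -> 0 < index w s -> (index w s).+1 < size s ->
    z \in s /\ consecutive s w z.
  move=> ws wz w0 w1.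
  have e1 : e w (nth x s (index w s).+1).
    by rewrite -{1}(nth_index x ws); apply: sorted_consecutive.
  have e2 : e w (nth x s (index w s).-1).
    rewrite e_sym -{2}(nth_index x ws) -{2}(prednK w0); apply: sorted_consecutive => //.
    by rewrite prednK // -idx_lt.
  have w2 : (index w s).-1 < size s by rewrite prednK // ltnW // -idx_lt.
  have ne : nth x s (index w s).+1 != nth x s (index w s).-1.
    by rewrite nth_uniq // neq_ltn; apply/orP; right; rewrite prednK.
  rewrite /consecutive; case: (third_neighbor e1 e2 ne wz) => ->.
    by rewrite mem_nth // index_uniq // eqxx.
  by rewrite mem_nth // index_uniq // prednK // eqxx orbT.
have vs : v \in s.
  case: (posnP (index u s)) => [u0|u0].
    apply: contraT => vs; have: size (v :: s) <= size s.
      apply: smax; rewrite ?inE ?xs ?orbT //= ?vs //.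
      case: (s) ss us u0 => //= z s' -> _; case: eqP => // -> _.
      by rewrite e_sym uv.
    by rewrite /= ltnn.
  case: (ltnP (index u s).+1 (size s)) => [u1|u1]; first by have [] := inner u v.
  apply: contraT => vs; have: size (rcons s v) <= size s.
    apply: smax; rewrite ?mem_rcons ?inE ?xs ?orbT ?rcons_uniq ?vs //.
    have iu : index u s = (size s).-1.
      have iu : index u s < size s by rewrite -idx_lt.
      by rewrite (_ : size s = (index u s).+1) //; apply/eqP; rewrite eqn_leq u1 iu.
    have ul : u = last u s by rewrite -nth_last -iu nth_index.
    case: (s) ss ul => //= z s' ps ul; rewrite rcons_path ps -ul.
    exact: uv.
  by rewrite size_rcons ltnn.
split=> //.
(* Inner vertices are adjacent to their path neighbours only, so any other edge joins the two
   distinct ends. *)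
case: (boolP ((0 < index u s) && ((index u s).+1 < size s))) => [/andP[u0 u1]|].
  by have [_ ->] := inner u v us uv u0 u1.
case: (boolP ((0 < index v s) && ((index v s).+1 < size s))) => [/andP[v0 v1] _|].
  have vu : e v u by rewrite e_sym.
  by have [_ /orP[] h] := inner v u vs vu v0 v1; rewrite /consecutive h ?orbT.
have iu : index u s < size s by rewrite -idx_lt.
have iv : index v s < size s by rewrite -idx_lt.
have uv_idx : index u s != index v s.
  by apply/eqP => /(index_inj u us vs) euv; rewrite euv e_irr in uv.
rewrite !negb_and -!eqn0Ngt -!leqNgt /wraps => hv hu.
have last_idx k : k < size s -> size s <= k.+1 -> k == (size s).-1.
  by move=> k1 k2; rewrite (_ : size s = k.+1) //; apply/eqP; rewrite eqn_leq k1 k2.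
case/orP: hu => [/eqP u0|/(last_idx _ iu) /eqP u1];
case/orP: hv => [/eqP v0|/(last_idx _ iv) /eqP v1].
- by rewrite u0 v0 eqxx in uv_idx.
- by rewrite u0 v1 !eqxx orbT.
- by rewrite v0 u1 !eqxx !orbT.
- by rewrite u1 v1 eqxx in uv_idx.
Qed.

Lemma component_enum_connect s x : component_enum s -> x \in s -> s =i connect e x.
Proof.
case=> su ss sc xs y; apply/idP/idP => [ys|].
  case: s su ss sc xs ys => // z s _ ss _ xs ys.
  have c := path_connect ss.
  rewrite inE; apply: (connect_trans (y := z)); last exact: c.
  by rewrite (sym_connect_sym e_sym); apply: c.
rewrite inE => /connectP[p]; elim: p x xs => [|a p IH] x xs /=; first by move=> _ ->.
by case/andP => xa pa; apply: IH => //; have [] := sc x a xs xa.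
Qed.

Lemma exists_component_partition :
  exists S : T -> seq T, seq_partition S /\ forall x, component_enum (S x).
Proof.
have [f fP] := fin_all_exists exists_component_enum.
(* Passing to the root gives all vertices of a component the same enumeration. *)
exists (fun x => f (fingraph.root e x)); split=> x; last by have [] := fP (fingraph.root e x).
have csym := sym_connect_sym e_sym.
have mem y z : (y \in f (fingraph.root e z)) = connect e (fingraph.root e z) y.
  by have [rz ce] := fP (fingraph.root e z); rewrite (component_enum_connect ce rz).
have [_ [? _ _]] := fP (fingraph.root e x); split=> //.
  by rewrite mem csym connect_root.
move=> y; rewrite mem => /(fingraph.rootP csym) <-.
by rewrite (root_root csym).
Qed.

(** An edge between the ends of a sequence with at least three entries would close it to a cycle;
    with two entries the ends are consecutive. *)
Lemma component_enum_consecutive s u v :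
  component_enum s -> ~~ ((2 < size s) && path.cycle e s) -> u \in s -> e u v -> consecutive s u v.
Proof.
move=> [su ss sc] ncyc us uv; have [vs /orP[//|w]] := sc u v us uv.
wlog [u0 vl] : u v us vs uv w / index u s = 0 /\ index v s = (size s).-1.
  move=> H; case/orP: (w) => /andP[/eqP a /eqP b]; first exact: H.
  have vu : e v u by rewrite e_sym.
  have wvu : wraps s v u by rewrite /wraps orbC.
  have -> : consecutive s u v = consecutive s v u by rewrite /consecutive orbC.
  exact: H.
move: ncyc; rewrite negb_and -leqNgt => /orP[s2|ncyc].
  rewrite /consecutive u0 vl.
  have: index u s != index v s.
    by apply/eqP => /(index_inj u us vs) euv; rewrite euv e_irr in uv.
  rewrite u0 vl; case: (size s) s2 => [|[|[|]]] //.
case/negP: ncyc; case: (s) us vs u0 vl ss => // z p us vs u0 vl ss.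
rewrite /= rcons_path; apply/andP; split=> //.
have zu : z = u by rewrite -(nth_index z us) u0.
have -> : last z p = v by rewrite -[RHS](nth_index u vs) vl nth_last.
by rewrite zu e_sym.
Qed.

Lemma component_enum_next s u v :
  component_enum s -> u \in s -> e u v -> v = next s u \/ u = next s v.
Proof.
move=> [su ss sc] us uv; have [vs] := sc u v us uv.
have nxt a b : a \in s -> b \in s -> index b s = (index a s).+1 -> b = next s a.
  move=> a_s bs ab; rewrite next_nth a_s; case: (s) a_s bs ab => // z p a_s bs ab.
  by rewrite -(nth_index z bs) ab.
have wrp a b : a \in s -> b \in s -> index b s = 0 -> index a s = (size s).-1 -> b = next s a.
  move=> a_s bs b0 al; rewrite next_nth a_s; case: (s) a_s bs b0 al => // z p a_s bs b0 al.
  by rewrite -(nth_index z bs) b0 al /= nth_default.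
case/orP => /orP[].
- by move/eqP => h; left; apply: nxt.
- by move/eqP => h; right; apply: nxt.
- by case/andP => /eqP h1 /eqP h2; right; apply: wrp.
- by case/andP => /eqP h1 /eqP h2; left; apply: wrp.
Qed.

Lemma component_enum_cycle s x :
  component_enum s -> x \in s -> 2 < size s -> path.cycle e s ->
  cycle_component e [set y in s].
Proof.
move=> sc xs s3 cyc; have [su ss _] := sc; split.
  by exists x; apply/setP => y; rewrite !inE (component_enum_connect sc xs).
exists s; split=> // [v|u v]; first by rewrite inE.
rewrite !inE => us vs; apply/idP/orP => [uv|].
  case: (component_enum_next sc us uv) => [->|->]; [left|right] => //.
  by rewrite prev_next.
case=> /eqP->; first exact: next_cycle.
by rewrite e_sym; apply: prev_cycle.
Qed.

End DegreeTwo.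

(** * Unions of two matchings *)

Lemma matching_involution (T : finType) (r : rel T) :
  symmetric r -> (forall x y z, r x y -> r x z -> y = z) ->
  exists mu : T -> T, involutive mu /\ forall x y, r x y -> mu x = y.
Proof.
move=> r_sym r_fun.
exists (fun x => if [pick y | r x y] is Some y then y else x).
have pickE x y : r x y -> [pick y | r x y] = Some y.
  by move=> xy; case: pickP => [z xz|/(_ y)]; [rewrite (r_fun _ _ _ xy xz)|rewrite xy].
split=> [x|x y /pickE-> //]; case: (pickP (r x)) => [y xy|nox].
  by rewrite (pickE y x) // r_sym.
by case: pickP => // y; rewrite nox.
Qed.

Lemma union_matchings_bipartite (T : finType) (r1 r2 : rel T) :
  symmetric r1 -> symmetric r2 -> irreflexive r1 -> irreflexive r2 ->
  (forall x y z, r1 x y -> r1 x z -> y = z) ->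
  (forall x y z, r2 x y -> r2 x z -> y = z) ->
  exists c : T -> bool, forall x y, r1 x y || r2 x y -> c x != c y.
Proof.
move=> s1 s2 i1 i2 f1 f2.
have [mu [muK muE]] := matching_involution s1 f1.
have [nu [nuK nuE]] := matching_involution s2 f2.
have [c cP] := involutions_bipartite muK nuK.
exists c => x y /orP[xy|xy]; have [cm cn] := cP x; rewrite eq_sym.
  by move: cm; rewrite (muE _ _ xy); apply; apply: contraTneq xy => ->; rewrite i1.
by move: cn; rewrite (nuE _ _ xy); apply; apply: contraTneq xy => ->; rewrite i2.
Qed.

(** * Four-colouring with at most one long odd cycle *)

Section Glue.
Variables (T : finType) (e : rel T) (q : nat) (Y : 'I_q -> {set T}).
Hypotheses (e_sym : symmetric e) (e_irr : irreflexive e) (e_deg : max_deg_le e 2).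
Hypotheses (Y_card : forall j, #|Y j| = 4).
Hypothesis (Y_disj : forall i j, i != j -> [disjoint Y i & Y j]).

Lemma glued_block_unique i j x : x \in Y i -> x \in Y j -> i = j.
Proof.
move=> xi xj; apply/eqP; apply: contraT => /Y_disj.
by rewrite disjoints_subset => /subsetP /(_ x xi); rewrite inE xj.
Qed.

Definition block_seq (x : T) : seq T :=
  if [pick j | x \in Y j] is Some j then enum (Y j) else [:: x].

Lemma block_seq_mem j x : x \in Y j -> block_seq x = enum (Y j).
Proof.
rewrite /block_seq => xj; case: pickP => [i xi|/(_ j)]; last by rewrite xj.
by rewrite (glued_block_unique xi xj).
Qed.

Lemma block_seq_partition : seq_partition block_seq.
Proof.
move=> x; case: (pickP (fun j => x \in Y j)) => [j xj|nox].
  rewrite (block_seq_mem xj); split; rewrite ?enum_uniq ?mem_enum // => y.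
  by rewrite mem_enum => /block_seq_mem.
have -> : block_seq x = [:: x].
  by rewrite /block_seq; case: pickP => // j; rewrite nox.
split; rewrite ?mem_head // => y; rewrite inE => /eqP ->.
by rewrite /block_seq; case: pickP => // j; rewrite nox.
Qed.

Let nu := partner block_seq.

Lemma block_partner_mem j x : x \in Y j -> nu x \in Y j.
Proof.
by move=> xj; have := partner_mem x block_seq_partition; rewrite (block_seq_mem xj) mem_enum.
Qed.

Lemma block_partner_neq j x : x \in Y j -> nu x != x.
Proof.
move=> xj; apply: (partner_neq block_seq_partition).
have : index x (block_seq x) < size (block_seq x).
  by rewrite index_mem (block_seq_mem xj) mem_enum.
rewrite (block_seq_mem xj) -cardE Y_card.
by case: (index _ _) => [|[|[|[|]]]].
Qed.

(** Within one class of [c], the edges of [e] form a matching by the second hypothesis, and the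
    block edges do so because partners are separated. A further bipartition [d] of both classes
    yields the four colours [(c, d)]. *)
Lemma colorable_of_split (c : T -> bool) :
  (forall x, nu x != x -> c (nu x) != c x) ->
  (forall x a b, e x a -> e x b -> c a = c x -> c b = c x -> a = b) ->
  colorable (glue e Y) 4.
Proof.
move=> cnu ce.
pose r1 := [rel x y | e x y && (c x == c y)].
pose r2 := [rel x y | [&& x != y, [exists j, (x \in Y j) && (y \in Y j)] & c x == c y]].
have [||||||d dP] := @union_matchings_bipartite T r1 r2.
- by move=> x y /=; rewrite e_sym eq_sym.
- move=> x y /=; rewrite eq_sym [c x == _]eq_sym; congr (_ && (_ && _)).
  by apply: eq_existsb => j; rewrite andbC.
- by move=> x /=; rewrite e_irr.
- by move=> x /=; rewrite eqxx.
- move=> x y z /= /andP[xy /eqP cxy] /andP[xz /eqP cxz].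
  exact: (ce x).
- move=> x y z /= /and3P[xy /existsP[j /andP[xj yj]] /eqP cxy].
  case/and3P=> xz /existsP[i /andP[xi zi]] /eqP cxz.
  have ji := glued_block_unique xi xj; rewrite {i xi}ji in zi.
  (* Otherwise [x], [y], [z] of one colour and the partners of [x] and [y], of the other, are five
     vertices in a block of size 4. *)
  apply/eqP; apply: contraTT (leqnn 4) => yz; rewrite -ltnNge -{2}(Y_card j).
  have cnx := cnu x (block_partner_neq xj); have cny := cnu y (block_partner_neq yj).
  have ux : uniq [:: x; y; z; nu x; nu y].
    have nxy : nu x != nu y by rewrite (inj_eq (inv_inj (partnerK block_seq_partition))).
    have dif u v : c u != c v -> u != v by apply: contra_neq => ->.
    have cn u : c u = c x -> (u != nu x) && (u != nu y).
      by move=> cu; rewrite !dif // cu eq_sym ?cnx // cxy cny.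
    have [/andP[xx xy'] /andP[yx yy] /andP[zx zy]] :=
      And3 (cn x erefl) (cn y (esym cxy)) (cn z (esym cxz)).
    by rewrite /= !inE !negb_or xy xz yz nxy xx xy' yx yy zx zy.
  rewrite -[5]/(size [:: x; y; z; nu x; nu y]) -(card_uniqP ux).
  apply/subset_leq_card/subsetP => u; rewrite !inE.
  by case/or4P => [/eqP->|/eqP->|/eqP->|/orP[]/eqP->]; rewrite ?block_partner_mem.
have card4 : #|{: bool * bool}| = 4 by rewrite card_prod card_bool.
exists (fun x => cast_ord card4 (enum_rank (c x, d x))) => x y xy.
apply/negP => /eqP /cast_ord_inj /enum_rank_inj [cxy dxy].
suff : d x != d y by rewrite dxy eqxx.
by apply: dP; move: xy; rewrite /glue /= cxy eqxx !andbT.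
Qed.

Lemma partner_adjacent (S : T -> seq T) x :
  seq_partition S -> (forall x, sorted e (S x)) -> partner S x != x -> e x (partner S x).
Proof.
move=> SP Ss; have [_ xS _] := SP x; rewrite /partner.
have := Ss x; set s := S x in xS *; move=> ss.
case: (ltnP (partner_index (index x s)) (size s)) => [|le]; last by rewrite nth_default ?eqxx.
have ix : index x s < size s by rewrite index_mem.
rewrite /partner_index; case E: (odd _) => lt _.
  have i0 : 0 < index x s by case: (index x s) E.
  have := @sorted_consecutive _ _ x s (index x s).-1 ss.
  by rewrite prednK // nth_index // e_sym; apply.
have := @sorted_consecutive _ _ x s (index x s) ss.
by rewrite nth_index //; apply.
Qed.

Lemma adjacent_color_differs (c : T -> bool) x w a b :
  e x w -> c w != c x -> e x a -> e x b -> c a = c x -> c b = c x -> a = b.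
Proof.
move=> xw cw xa xb ca cb; apply/eqP; apply: contraT => ab.
by case: (third_neighbor e_deg xa xb ab xw) cw => ->; rewrite ?ca ?cb eqxx.
Qed.

(** The unmatched vertex is the last of an odd number of entries. On a path it has at most one
    neighbour; in a triangle its two neighbours are partners, hence of different colours. Only a
    longer odd cycle remains. *)
Lemma unmatched_vertex (S : T -> seq T) (c : T -> bool) x a b :
  seq_partition S -> (forall x, component_enum e (S x)) ->
  (forall z, z \in S x -> partner S z != z -> c (partner S z) != c z) ->
  partner S x = x -> e x a -> e x b -> c a = c x -> c b = c x -> a != b ->
  [/\ odd (size (S x)), 3 < size (S x) & path.cycle e (S x)].
Proof.
move=> SP Sc cP px xa xb ca cb ab.
have [su xS Sx] := SP x; have [_ ss sc] := Sc x.
have ix : index x (S x) < size (S x) by rewrite index_mem.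
have le : size (S x) <= partner_index (index x (S x)).
  rewrite leqNgt; apply/negP => lt.
  by have := partner_neq SP lt; rewrite px eqxx.
have [ev xl] : ~~ odd (index x (S x)) /\ size (S x) = (index x (S x)).+1.
  move: le; rewrite /partner_index; case: (odd _) => le; last first.
    by split=> //; apply/eqP; rewrite eqn_leq le.
  by have := leq_trans ix (leq_trans le (leq_pred _)); rewrite ltnn.
have [aS _] := sc x a xS xa; have [bS _] := sc x b xS xb.
have cyc : (2 < size (S x)) && path.cycle e (S x).
  apply: contraT => ncyc.
  have prev v : v \in S x -> e x v -> index x (S x) = (index v (S x)).+1.
    move=> vS xv; have := component_enum_consecutive e_sym e_irr (Sc x) ncyc xS xv.
    case/orP => /eqP // h; have : index v (S x) < size (S x) by rewrite index_mem.
    by rewrite h xl ltnn.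
  case/eqP: ab; apply: (index_inj a aS bS); apply: succn_inj.
  by rewrite -!prev.
case/andP: cyc => s3 cyc; split=> //; first by rewrite xl.
rewrite ltn_neqAle s3 andbT; apply/eqP => s3'.
wlog lt : a b xa xb ca cb ab aS bS / index a (S x) < index b (S x).
  move=> H; case: (ltngtP (index a (S x)) (index b (S x))) => lt.
  - exact: (H a b).
  - by apply: (H b a) => //; rewrite eq_sym.
  - by case/eqP: ab; apply: (index_inj a aS bS).
have ib : index b (S x) < 2.
  have : index b (S x) < 3 by rewrite s3' index_mem.
  rewrite ltnS leq_eqVlt => /orP[/eqP b2|//].
  have x2 : index x (S x) = 2 by apply: succn_inj; rewrite -xl.
  have bx : b = x by apply: (index_inj b bS xS); rewrite b2 x2.
  by rewrite bx e_irr in xb.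
have b1 : index b (S x) = 1 by case: (index b _) lt ib => [|[|]].
have a0 : index a (S x) = 0 by apply/eqP; rewrite -leqn0 -ltnS -b1.
have pa : partner S a = b.
  by rewrite /partner (Sx a aS) a0 /partner_index /= -b1 nth_index.
have := cP a aS; rewrite pa ca cb eqxx eq_sym => /(_ ab).
by [].
Qed.

Definition long_odd_enum (s : seq T) := [&& odd (size s), 3 < size s & path.cycle e s].

Lemma long_odd_enum_cycle s x : component_enum e s -> x \in s -> long_odd_enum s ->
  long_odd_cycle e [set z in s].
Proof.
move=> sc xs /and3P[so s3 cyc]; have [su _ _] := sc.
have cs : #|[set z in s]| = size s by rewrite cardsE (card_uniqP su).
split; rewrite ?cs //; apply: component_enum_cycle xs _ cyc => //.
exact: ltnW.
Qed.

(* A vertex [y] of the long odd cycle is left unmatched in such a way that the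
   Kempe component of [y] avoids the other vertices of the cycle. *)
Lemma isolated_cycle_vertex (mu : T -> T) (s : seq T) :
  involutive mu -> uniq s -> odd (size s) -> (forall x, x \in s -> mu x = x) ->
  exists2 y, y \in s &
    forall z, z \in s -> fconnect (fun x => mu (nu x)) y z -> z = y.
Proof.
move=> muK su so mus; set rho := fun x => mu (nu x).
have nuK : involutive nu := partnerK block_seq_partition.
pose other y := [pick z | [&& z \in s, z != y & fconnect rho y z]].
(* If every orbit through [s] met [s] again, [f] would be a fixed-point-free involution of [s],
   because an orbit holds at most two fixed points of [mu]; but [s] has odd size. *)
pose f y := if other y is Some z then z else y.
case: (boolP [exists y in s, ~~ other y]) => [/existsP[y /andP[ys]]|].
  rewrite /other; case: pickP => // noz _; exists y => // z zs yz.
  by apply/eqP; move: (noz z); rewrite zs yz andbT => /negbFE.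
rewrite negb_exists => /forallP all_other.
have fP y : y \in s -> [/\ f y \in s, f y != y & fconnect rho y (f y)].
  move=> ys; move: (all_other y); rewrite ys /= negbK /f /other.
  by case: pickP => // z /and3P[].
suff: ~~ odd #|[set z in s]| by rewrite cardsE (card_uniqP su) so.
apply: (card_involution_even (f := f)) => x; rewrite !inE => xs.
- by have [] := fP x xs.
- have [fs fx xf] := fP x xs; have [ffs ffx fxf] := fP _ fs.
  apply: (fixed_points_le2 muK nuK (x := f x)); rewrite ?mus // 1?eq_sym //.
  by rewrite (rho_connect_sym muK nuK).
- by have [] := fP x xs.
Qed.

Theorem colorable_one_long_odd_cycle : at_most_one_long_odd_cycle e -> colorable (glue e Y) 4.
Proof.
move=> one; have [S [SP Sc]] := exists_component_partition e_sym e_irr e_deg.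
have nuK : involutive nu := partnerK block_seq_partition.
have Ss x : sorted e (S x) by have [] := Sc x.
case: (boolP [exists y, long_odd_enum (S y)]) => [/existsP[y0]|]; last first.
  move/existsPn => nolong.
  have [c cP] := involutions_bipartite (partnerK SP) nuK.
  apply: (colorable_of_split (c := c)) => [x|x a b xa xb ca cb].
    by have [_] := cP x.
  have cmu z : partner S z != z -> c (partner S z) != c z by have [] := cP z.
  have [px|px] := eqVneq (partner S x) x; last first.
    exact: adjacent_color_differs (partner_adjacent SP Ss px) (cmu x px) xa xb ca cb.
  apply/eqP; apply: contraT => ab; case/negP: (nolong x); apply/and3P.
  exact: unmatched_vertex SP Sc (fun z _ => cmu z) px xa xb ca cb ab.
set s := S y0 => slong; have /and3P[so s3 cyc] := slong.
have [su y0s Sy0] := SP y0; rewrite -/s in su y0s Sy0.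
have Sin x : x \in s -> S x = s by move=> /Sy0.
have Sout x z : x \notin s -> z \in S x -> z \notin s.
  move=> xs zx; apply: contra xs => /Sin Sz; have [_ xS Sx] := SP x.
  by rewrite -Sz (Sx z zx).
(* Leaving the whole long cycle unmatched turns its vertices into fixed points, as the choice of [y]
   requires. *)
pose mu0 x := if x \in s then x else partner S x.
have mu0K : involutive mu0.
  move=> x; rewrite /mu0; case: (boolP (x \in s)) => xs; first by rewrite xs.
  by rewrite (negbTE (Sout x _ xs (partner_mem x SP))) partnerK.
have mu0s x : x \in s -> mu0 x = x by rewrite /mu0 => ->.
have [y ys yiso] := isolated_cycle_vertex mu0K su so mu0s.
pose K := [pred z | fconnect (fun x => mu0 (nu x)) y z].
have [i s1 rots] := rot_to ys.
(* The cycle is rotated to end in [y], so that its odd length leaves exactly [y] without partner. *)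
pose s' := rcons s1 y.
have s'rot : s' = rot 1 (rot i s) by rewrite rots rot1_cons.
have s's : s' =i s by move=> z; rewrite s'rot !mem_rot.
have su' : uniq s' by rewrite s'rot !rot_uniq.
have size_s' : size s' = size s by rewrite s'rot !size_rot.
pose S' x := if x \in s then s' else S x.
have SP' : seq_partition S'.
  move=> x; rewrite /S'; case: (boolP (x \in s)) => xs.
    by split=> // [|z]; rewrite s's // => ->.
  by have [? ? Sx] := SP x; split=> // z zx; rewrite (negbTE (Sout x z xs zx)) Sx.
have Ss' x : sorted e (S' x).
  rewrite /S'; case: ifP => // _.
  have : path.cycle e s' by rewrite s'rot !rot_cycle.
  by case: (s') => // z p /=; rewrite rcons_path => /andP[].
have muout x : x \notin s -> partner S' x = mu0 x.
  by move=> xs; rewrite /mu0 /partner /S' (negbTE xs).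
have iy : index y s' = (size s).-1.
  rewrite -size_s' size_rcons /= /s' -cats1 index_cat ifN.
    by rewrite /= eqxx addn0.
  by move: su'; rewrite /s' rcons_uniq => /andP[].
have s0 : 0 < size s by apply: ltn_trans s3.
have mus x : x \in s -> (partner S' x == x) = (x == y).
  move=> xs; apply/idP/eqP => [|->].
    apply: contraTeq => xy; apply: (partner_neq SP'); rewrite /S' xs size_s'.
    have: index x s' < (size s).-1.
      rewrite ltn_neqAle -iy; apply/andP; split.
        by apply: contraNneq xy => /(index_inj x _ _) ->; rewrite ?s's.
      by rewrite iy -ltnS (prednK s0) -size_s' index_mem s's.
    rewrite /partner_index; case: (odd _) => lt.
      exact: leq_ltn_trans (leq_pred _) (leq_trans lt (leq_pred _)).
    by rewrite -(prednK s0) ltnS.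
  rewrite /partner /S' ys nth_default // iy size_s' /partner_index.
  move: so s3; case: (size s) => // n; rewrite /= => /negbTE -> _.
  by [].
have yK : y \in K by rewrite inE connect0.
have Kmu0 z : z \in K -> mu0 z \in K.
  by rewrite !inE; apply: fconnect_mu => //; apply: mu0s.
have Knu z : z \in K -> nu z \in K.
  by rewrite !inE; apply: fconnect_nu => //; apply: mu0s.
(* [K] was built from [mu0], but the new matching preserves it too: [K] meets the long cycle only in
   [y], which stays unmatched. *)
have Kmu z : z \in K -> partner S' z \in K.
  move=> zK; case: (boolP (z \in s)) => zs; last by rewrite muout // Kmu0.
  have zy : z = y by apply: yiso.
  by have := mus z zs; rewrite zy eqxx => /eqP ->.
(* This neighbour of [y] lies outside [K], so its colour can be made to differ from that of [y]. *)
pose u := next s y.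
have us : u \in s by rewrite mem_next.
have yu : e y u by apply: next_cycle.
have uK : u \notin K.
  by apply: contraTN yu => /(yiso u us) ->; rewrite e_irr.
have Kiff f : involutive f -> (forall z, z \in K -> f z \in K) -> forall z, (f z \in K) = (z \in K).
  by move=> fK fKK z; apply/idP/idP => /fKK //; rewrite fK.
have [c [cP cyu]] := involutions_bipartite_separate (partnerK SP') nuK
  (Kiff _ (partnerK SP') Kmu) (Kiff _ nuK Knu) yK uK.
apply: (colorable_of_split (c := c)) => [x|x a b xa xb ca cb]; first by have [_] := cP x.
have cmu z : partner S' z != z -> c (partner S' z) != c z by have [] := cP z.
have [px|px] := eqVneq (partner S' x) x; last first.
  exact: adjacent_color_differs (partner_adjacent SP' Ss' px) (cmu x px) xa xb ca cb.
case: (boolP (x \in s)) => xs.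
  have xy : x = y by apply/eqP; rewrite -mus // px.
  by apply: (adjacent_color_differs (c := c) (w := u)) xa xb ca cb; rewrite xy // eq_sym.
(* Off [s] the pairing is the original one, and a failure at [x] would exhibit a second long odd
   cycle. *)
apply/eqP; apply: contraT => ab.
have S'S z : z \notin s -> partner S' z = partner S z.
  by move=> zs; rewrite /partner /S' (negbTE zs).
have cS z : z \in S x -> partner S z != z -> c (partner S z) != c z.
  by move=> /(Sout x z xs) zs; rewrite -S'S //; apply: cmu.
have pSx : partner S x = x by rewrite -S'S.
have longx : long_odd_enum (S x).
  exact/and3P/(unmatched_vertex SP Sc cS pSx xa xb ca cb ab).
have [_ xS _] := SP x; case/negP: xs.
have /setP /(_ x) := one _ _ (long_odd_enum_cycle (Sc x) xS longx)
  (long_odd_enum_cycle (Sc y0) y0s slong).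
by rewrite !inE xS => <-.
Qed.

End Glue.

(** * Hall's marriage theorem *)

Section Hall.
Variables (I J : finType).

Definition joint_neighbors (r : I -> J -> bool) (K : {set I}) : {set J} :=
  [set j | [exists i in K, r i j]].

(** The matching is a partial map from [J] to [I], which makes the chosen [j] distinct for distinct
    [i]. By induction on [A]: a tight proper subset [K] is matched first and the rest avoids its
    neighbours; if none is tight, any pair [i0], [j0] can be removed. *)
Theorem hall_marriage (r : I -> J -> bool) (A : {set I}) :
  (forall K : {set I}, K \subset A -> #|K| <= #|joint_neighbors r K|) ->
  exists g : J -> option I, forall i, i \in A -> exists j, g j = Some i /\ r i j.
Proof.
have [n] := ubnP #|A|; elim: n => // n IH in r A *; rewrite ltnS => An hall.
have [->|[i0 i0A]] := set_0Vmem A; first by exists (fun=> None) => i; rewrite inE.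
case: (boolP [exists K : {set I}, [&& K \proper A, K != set0 & #|joint_neighbors r K| <= #|K|]]).
  case/existsP => K /and3P[KA K0 tight].
  have ltK : #|K| < n by apply: leq_trans (proper_card KA) An.
  have [|g1 g1P] := IH r K ltK.
    by move=> L LK; apply: hall; apply: subset_trans LK (proper_sub KA).
  pose r' i j := r i j && (j \notin joint_neighbors r K).
  have ltAK : #|A :\: K| < n.
    apply: leq_trans An; apply: proper_card; rewrite properE subsetDl /=.
    have /set0Pn[i iK] := K0; apply/subsetPn; exists i.
      exact: (subsetP (proper_sub KA)).
    by rewrite !inE iK.
  have [|g2 g2P] := IH r' (A :\: K) ltAK.
    move=> L LAK; have disLK : [disjoint L & K].
      rewrite disjoints_subset; apply: subset_trans LAK _.
      by apply/subsetP => i; rewrite !inE => /andP[].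
    (* The tight bound for [K] is subtracted from Hall's condition for [L :|: K]. *)
    rewrite -(leq_add2r #|K|) -cardsUI (_ : L :&: K = set0) ?cards0 ?addn0; last first.
      by apply/eqP; rewrite setI_eq0.
    apply: leq_trans (hall (L :|: K) _) _.
      rewrite subUset (proper_sub KA) andbT.
      exact: subset_trans LAK (subsetDl _ _).
    apply: leq_trans (_ : #|joint_neighbors r' L :|: joint_neighbors r K| <= _).
      apply/subset_leq_card/subsetP => j; rewrite !inE => /existsP[i].
      rewrite inE => /andP[/orP[iL|iK] rij]; apply/orP.
        case: (boolP (j \in joint_neighbors r K)) => jK; [right|left].
          by move: jK; rewrite inE.
        by apply/existsP; exists i; rewrite iL /r' rij jK.
      by right; apply/existsP; exists i; rewrite iK.
    by apply: leq_trans (leq_card_setU _ _) _; rewrite leq_add2l.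
  exists (fun j => if j \in joint_neighbors r K then g1 j else g2 j) => i iA.
  case: (boolP (i \in K)) => iK.
    have [j [gj rij]] := g1P i iK; exists j; rewrite ifT //.
    by rewrite inE; apply/existsP; exists i; rewrite iK.
  have [|j [gj /andP[rij jK]]] := g2P i; first by rewrite inE iK.
  by exists j; rewrite (negbTE jK).
move=> /existsPn loose.
have [j0 r0] : exists j0, r i0 j0.
  have : 0 < #|joint_neighbors r [set i0]|.
    by have := hall [set i0]; rewrite cards1 sub1set => ->.
  by case/card_gt0P => j; rewrite inE => /existsP[i]; rewrite inE => /andP[/eqP-> ?]; exists j.
pose r' i j := r i j && (j != j0).
have [||g gP] := IH r' (A :\ i0).
- by apply: leq_trans An; rewrite (cardsD1 i0 A) i0A.
- move=> K KA; have [->|K0] := eqVneq K set0; first by rewrite cards0.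
  have KpA : K \proper A.
    rewrite properE (subset_trans KA (subsetDl _ _)) /=; apply/subsetPn; exists i0 => //.
    by apply: contraTN KA => i0K; apply/subsetPn; exists i0; rewrite ?inE ?eqxx.
  have := loose K; rewrite KpA K0 /= -ltnNge => lt; rewrite -ltnS; apply: leq_trans lt _.
  rewrite (cardsD1 j0) -[X in _ <= X]add1n leq_add ?leq_b1 //.
  apply/subset_leq_card/subsetP => j; rewrite !inE => /andP[jj0 /existsP[i /andP[iK rij]]].
  by apply/existsP; exists i; rewrite iK /r' rij.
exists (fun j => if j == j0 then Some i0 else g j) => i iA.
have [->|ii0] := eqVneq i i0; first by exists j0; rewrite eqxx.
have [|j [gj /andP[rij jj0]]] := gP i; first by rewrite !inE ii0.
by exists j; rewrite (negbTE jj0).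
Qed.

End Hall.

(** * Greedy colouring and concatenated sequences *)

Lemma colorable_extend (T : finType) (g : rel T) k (X : {set T}) (f : T -> 'I_k) :
  symmetric g -> irreflexive g ->
  (forall u v, u \in X -> v \in X -> g u v -> f u != f v) ->
  (forall x, x \notin X -> #|[set y | g x y]| < k) -> colorable g k.
Proof.
move=> g_sym g_irr; have [n] := ubnP #|~: X|; elim: n => // n IH in X f *.
rewrite ltnS => Xn fP deg; case: (set_0Vmem (~: X)) => [X0|[x]].
  by exists f => u v; apply: fP; rewrite -[X]setCK X0 setC0 inE.
rewrite inE => xX.
(* Fewer than [k] neighbours leave a colour free at [x]. *)
have [a aP] : exists a, a \notin f @: [set y | g x y].
  apply/existsP; apply: contraTT (deg x xX) => /existsPn full.
  rewrite -leqNgt; apply: leq_trans (leq_imset_card f _).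
  rewrite -{1}(card_ord k); apply/subset_leq_card/subsetP => a _.
  by have := full a; rewrite negbK.
apply: (IH (x |: X) (fun y => if y == x then a else f y)).
- have -> : ~: (x |: X) = (~: X) :\ x by apply/setP => y; rewrite !inE negb_or.
  by apply: leq_trans Xn; rewrite (cardsD1 x (~: X)) inE xX.
- have fa y : g x y -> a != f y.
    by move=> xy; apply: contraNneq aP => ->; apply: imset_f; rewrite inE.
  move=> u v; rewrite !inE; case: (eqVneq u x) => [->|ux]; case: (eqVneq v x) => [->|vx] //=.
  + by rewrite g_irr.
  + by move=> _ _; apply: fa.
  + by move=> _ _; rewrite g_sym eq_sym; apply: fa.
  + exact: fP.
- by move=> y; rewrite !inE negb_or => /andP[_]; apply: deg.
Qed.

Lemma uniq_flatten_disjoint (T : eqType) (ss : seq (seq T)) :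
  uniq ss -> (forall s, s \in ss -> uniq s) ->
  (forall s t x, s \in ss -> t \in ss -> x \in s -> x \in t -> s = t) ->
  uniq (flatten ss).
Proof.
elim: ss => //= s ss IH /andP[sss uss] us dis; rewrite cat_uniq us ?mem_head //=.
rewrite IH //; first last.
- by move=> t t' x ts t's; apply: dis; rewrite inE ?ts ?t's orbT.
- by move=> t ts; apply: us; rewrite inE ts orbT.
rewrite andbT; apply/hasPn => x /flattenP[t ts xt]; apply: contra sss => xs.
by rewrite (dis s t x) ?mem_head // inE ts orbT.
Qed.

Lemma consecutive_split (T : eqType) (s : seq T) u v :
  u \in s -> v \in s -> index v s = (index u s).+1 ->
  exists s1 s2, s = s1 ++ u :: v :: s2.
Proof.
move=> us vs uv; exists (take (index u s) s), (drop (index v s).+1 s).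
have iu : index u s < size s by rewrite index_mem.
have iv : index v s < size s by rewrite index_mem.
rewrite -[LHS](cat_take_drop (index u s)); congr (_ ++ _).
by rewrite (drop_nth u iu) nth_index // -uv (drop_nth u iv) nth_index.
Qed.

(** * Four-colouring with at most three triangles *)

Section FewTriangles.
Variables (T : finType) (e : rel T) (q : nat) (Y : 'I_q -> {set T}).
Hypotheses (e_sym : symmetric e) (e_irr : irreflexive e) (e_deg : max_deg_le e 2).
Hypotheses (Y_card : forall j, #|Y j| = 4).
Hypothesis (Y_disj : forall i j, i != j -> [disjoint Y i & Y j]).

(** Components with all degrees two are the cycles. Only those inside the blocks matter, since
    vertices outside every block are coloured greedily at the end. *)
Definition inner_cycles : {set {set T}} :=
  [set C | [&& [exists x, C == component e x], [forall y in C, #|[set z | e y z]| == 2]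
             & C \subset \bigcup_j Y j]].

Lemma inner_cycle_closed C y z : C \in inner_cycles -> y \in C -> e y z -> z \in C.
Proof.
rewrite inE => /and3P[/existsP[x /eqP->] _ _]; rewrite !inE => xy yz.
exact: connect_trans xy (connect1 yz).
Qed.

Lemma inner_cycle_neighbors C y : C \in inner_cycles -> y \in C ->
  #|[set z | e y z]| = 2 /\ [set z | e y z] \subset C :\ y.
Proof.
move=> CC yC; split.
  by move: CC; rewrite inE => /and3P[_ /forallP /(_ y) /implyP /(_ yC) /eqP].
apply/subsetP => z; rewrite !inE => yz; rewrite (inner_cycle_closed CC yC yz) andbT.
by apply: contraTneq yz => ->; rewrite e_irr.
Qed.

Lemma inner_cycle_nonempty C : C \in inner_cycles -> exists y, y \in C.
Proof. by rewrite inE => /and3P[/existsP[x /eqP->] _ _]; exists x; rewrite inE connect0. Qed.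

Lemma inner_cycle_card C : C \in inner_cycles -> 2 < #|C|.
Proof.
move=> CC; have [y yC] := inner_cycle_nonempty CC.
have [<- sub] := inner_cycle_neighbors CC yC.
by rewrite (cardsD1 y C) yC ltnS subset_leq_card.
Qed.

Lemma inner_cycle_triangle C : C \in inner_cycles -> #|C| = 3 -> C \in triangles e.
Proof.
move=> CC C3; rewrite inE C3 eqxx /=; apply/forallP => y; apply/implyP => yC.
apply/forallP => z; apply/implyP => zC; apply/implyP => yz.
have [N2 sub] := inner_cycle_neighbors CC yC.
have : [set z | e y z] == C :\ y.
  by rewrite eqEcard sub N2; have := cardsD1 y C; rewrite yC C3 add1n => -[<-].
by move/eqP/setP/(_ z); rewrite !inE eq_sym yz zC.
Qed.

Lemma inner_cycles_disjoint C D x :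
  C \in inner_cycles -> D \in inner_cycles -> x \in C -> x \in D -> C = D.
Proof.
rewrite inE => /and3P[/existsP[y /eqP->] _ _]; rewrite inE => /and3P[/existsP[z /eqP->] _ _].
rewrite !inE => yx zx; apply/setP => w; rewrite !inE.
have csym := sym_connect_sym e_sym.
by rewrite (same_connect csym yx) (same_connect csym zx).
Qed.

(** The cycles in [K] are disjoint and have at least four vertices each, except for at most three
    triangles, so they cover at least [4 * #|K| - 3] vertices. These lie in the neighbouring blocks
    of size 4, and a deficit of 3 is too small to lose a whole block. *)
Lemma inner_cycles_hall (K : {set {set T}}) :
  #|triangles e| <= 3 -> K \subset inner_cycles ->
  #|K| <= #|joint_neighbors (fun (C : {set T}) j => C :&: Y j != set0) K|.
Proof.
move=> tri /subsetP KA; set N := joint_neighbors _ _.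
have triv : trivIset K.
  apply/trivIsetP => C D CK DK; apply: contraR.
  rewrite -setI_eq0 => /set0Pn[x]; rewrite inE => /andP[xC xD].
  by apply/eqP/(inner_cycles_disjoint (KA _ CK) (KA _ DK) xC xD).
have covK : cover K \subset cover (Y @: N).
  apply/subsetP => x /bigcupP[C CK xC]; have := KA C CK; rewrite inE => /and3P[_ _ /subsetP].
  case/(_ x xC)/bigcupP => j _ xj; apply/bigcupP; exists (Y j) => //; apply: imset_f.
  rewrite inE; apply/existsP; exists C; rewrite CK /=; apply/set0Pn; exists x.
  by rewrite inE xC.
have upper : #|cover K| <= #|N| * 4.
  apply: leq_trans (subset_leq_card covK) _.
  apply: leq_trans (leq_card_cover _) _.
  rewrite (eq_bigr (fun=> 4)) => [|A /imsetP[j _ ->] //].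
  by rewrite sum_nat_const leq_mul2r leq_imset_card orbT.
have lower : #|K| * 4 <= #|cover K| + 3.
  have : \sum_(C in K) 4 <= \sum_(C in K) (#|C| + (C \in triangles e)).
    apply: leq_sum => C CK; have := inner_cycle_card (KA C CK).
    rewrite leq_eqVlt => /orP[/eqP C3|C4].
      by rewrite inner_cycle_triangle ?KA // -C3.
    exact: leq_trans C4 (leq_addr _ _).
  rewrite sum_nat_const big_split /= (eqP triv) => h; apply: leq_trans h _.
  rewrite leq_add2l; apply: leq_trans tri; rewrite -sum1_card big_mkcond [X in _ <= X]big_mkcond.
  by apply: leq_sum => C _; case: (C \in K); case: (C \in triangles e).
rewrite -ltnS -(ltn_pmul2r (isT : 0 < 4)) mulSn addnC ltnNge; apply/negP => lt.
have := leq_trans lt (leq_trans lower _) => /(_ (#|N| * 4 + 3)).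
by rewrite leq_add2r upper => /(_ isT); rewrite leq_add2l.
Qed.

Lemma exists_hitting_transversal : #|triangles e| <= 3 ->
  exists r : 'I_q -> T, (forall j, r j \in Y j) /\
    forall C, C \in inner_cycles -> exists j, r j \in C.
Proof.
move=> tri; have [g gP] := hall_marriage (fun K => inner_cycles_hall tri (K := K)).
(* A block matched to no cycle takes an arbitrary representative. *)
have rP j : exists x, x \in Y j /\
    forall C, g j = Some C -> C :&: Y j != set0 -> x \in C.
  have [y yj] : exists y, y \in Y j by apply/card_gt0P; rewrite Y_card.
  case: (g j) => [C|]; last by exists y.
  have [C0|[x]] := set_0Vmem (C :&: Y j).
    by exists y; split=> // D [<-]; rewrite C0 eqxx.
  by rewrite inE => /andP[xC xj]; exists x; split=> // D [<-].
have [r rP'] := fin_all_exists rP; exists r; split=> [j|C CC]; first by have [] := rP' j.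
have [j [gj Cj]] := gP C CC; exists j.
by have [_ rC] := rP' j; apply: rC gj Cj.
Qed.

Section RemoveTransversal.
Variable r : 'I_q -> T.
Hypothesis rY : forall j, r j \in Y j.
Hypothesis r_hits : forall C, C \in inner_cycles -> exists j, r j \in C.

Definition rest : {set T} := [set x | [exists j, (x \in Y j) && (x != r j)]].

Let e' : rel T := fun u v => [&& e u v, u \in rest & v \in rest].

Lemma rest_sym : symmetric e'.
Proof. by move=> u v; rewrite /e' e_sym andbCA [(v \in _) && _]andbC andbCA. Qed.

Lemma rest_irr : irreflexive e'.
Proof. by move=> u; rewrite /e' e_irr. Qed.

Lemma rest_deg : max_deg_le e' 2.
Proof.
move=> x; apply: leq_trans (e_deg x); apply/subset_leq_card/subsetP => y.
by rewrite !inE => /and3P[].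
Qed.

Lemma transversal_notin_rest j : r j \notin rest.
Proof.
rewrite inE; apply/existsPn => i; apply/negP => /andP[ri ne].
by rewrite (glued_block_unique Y_disj ri (rY j)) eqxx in ne.
Qed.

(** By the degree bound a cycle in [rest] would be a whole component of [e] inside the blocks, hence
    would contain some [r j], which is not in [rest]. *)
Lemma rest_acyclic s : uniq s -> 2 < size s -> ~~ path.cycle e' s.
Proof.
move=> su s3; apply/negP => cyc.
have nx u : u \in s -> e' u (next s u) by apply: next_cycle.
have pv u : u \in s -> e' u (prev s u) by move=> us; rewrite rest_sym; apply: prev_cycle.
(* Having more than two entries, [s] gives [u] two distinct neighbours, which leaves none outside
   [s]. *)
have ne u : u \in s -> next s u != prev s u.
  move=> us; apply/eqP => np; have nn : next s (next s u) = u by rewrite np next_prev.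
  have [i s1 rots] := rot_to us; move: nn; rewrite -!(next_rot i su).
  have : uniq (rot i s) by rewrite rot_uniq.
  have : 2 < size (rot i s) by rewrite size_rot.
  rewrite rots; case: s1 {rots} => [|a [|b s1]] //= _; rewrite !inE !negb_or eqxx.
  case/andP=> /and3P[ua ub _] _; rewrite (eq_sym a u) (negbTE ua) eqxx => bu.
  by rewrite bu eqxx in ub.
have clos u v : u \in s -> e u v -> v \in s.
  move=> us uv; have /and3P[en _ _] := nx u us; have /and3P[ep _ _] := pv u us.
  by case: (third_neighbor e_deg en ep (ne u us) uv) => ->; rewrite ?mem_next ?mem_prev.
have [x xs] : exists x, x \in s by case: (s) s3 => // x s1 _; exists x; rewrite mem_head.
have comp z : (z \in component e x) = (z \in s).
  rewrite inE; apply/idP/idP.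
    case/connectP => p; elim: p (x) xs => [|a p IH] y ys /=; first by move=> _ ->.
    by case/andP => ya pa; apply: IH => //; apply: clos ya.
  move=> zs; have [i s1 rots] := rot_to xs.
  have : path.cycle e (rot i s).
    by rewrite rot_cycle; apply: sub_cycle cyc => u v /and3P[].
  rewrite rots /= rcons_path => /andP[/path_connect c _]; apply: c.
  by rewrite -[z \in _]/(z \in x :: s1) -rots mem_rot.
have srest z : z \in s -> z \in rest by move=> /nx /and3P[].
have [|j] := r_hits (C := component e x); last first.
  by rewrite comp => /srest; apply/negP/transversal_notin_rest.
rewrite inE; apply/and3P; split; first by apply/existsP; exists x.
  apply/forallP => y; apply/implyP; rewrite comp => ys.
  rewrite eqn_leq e_deg /=.
  have <- : #|[set next s y; prev s y]| = 2 by rewrite cards2 ne.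
  apply/subset_leq_card/subsetP => z; rewrite !inE => /orP[] /eqP->.
    by have /and3P[] := nx y ys.
  by have /and3P[] := pv y ys.
apply/subsetP => z; rewrite comp => /srest; rewrite inE => /existsP[j /andP[zj _]].
by apply/bigcupP; exists j.
Qed.

(** The components of [e'] are paths, and concatenating them into one path only adds adjacencies. *)
Lemma exists_linear_order :
  exists h : seq T, [/\ uniq h, forall x, x \in h &
    forall u v, e' u v -> exists h1 h2, h = h1 ++ u :: v :: h2 \/ h = h1 ++ v :: u :: h2].
Proof.
have [S [SP Sc]] := exists_component_partition rest_sym rest_irr rest_deg.
pose ss := undup [seq S x | x <- enum T].
have memss x : S x \in ss by rewrite mem_undup map_f // mem_enum.
exists (flatten ss); split.
- apply: uniq_flatten_disjoint; first exact: undup_uniq.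
    by move=> s; rewrite mem_undup => /mapP[x _ ->]; have [] := SP x.
  move=> s t x; rewrite !mem_undup => /mapP[y _ ->] /mapP[z _ ->].
  have [_ _ Sy] := SP y; have [_ _ Sz] := SP z.
  by move=> /Sy <- /Sz <-.
- by move=> x; apply/flattenP; exists (S x) => //; have [] := SP x.
move=> u v uv; have [su us _] := SP u.
have [_ _ sc] := Sc u; have [vs _] := sc u v us uv.
have ncyc : ~~ ((2 < size (S u)) && path.cycle e' (S u)).
  by apply/negP => /andP[s3]; apply/negP/rest_acyclic.
have cons := component_enum_consecutive rest_sym rest_irr (Sc u) ncyc us uv.
have [a [b ab]] : exists a b, ss = a ++ S u :: b.
  by have /splitPr[a b] := memss u; exists a, b.
rewrite ab flatten_cat /=; case/orP: cons => /eqP h.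
  have [s1 [s2 ->]] := consecutive_split us vs h.
  by exists (flatten a ++ s1), (s2 ++ flatten b); left; rewrite -!catA.
have [s1 [s2 ->]] := consecutive_split vs us h.
by exists (flatten a ++ s1), (s2 ++ flatten b); right; rewrite -!catA.
Qed.

Lemma rest_three_colorable :
  exists c : T -> 'I_3, forall u v, u \in rest -> v \in rest -> glue e Y u v -> c u != c v.
Proof.
have [h [uh fh adj]] := exists_linear_order.
pose block j := enum (Y j :\ r j).
have size_block j : size (block j) = 3.
  by rewrite -cardE; have := cardsD1 (r j) (Y j); rewrite rY Y_card add1n => -[].
pose key x : option ('I_q * 'I_3) :=
  if [pick j | (x \in Y j) && (x != r j)] is Some j then Some (j, inord (index x (block j)))
  else None.
pose unkey (p : 'I_q * 'I_3) := nth (r p.1) (block p.1) p.2.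
have in_block x j : (x \in block j) = (x \in Y j) && (x != r j).
  by rewrite mem_enum !inE andbC.
have keyE x j : (x \in Y j) -> (x != r j) -> key x = Some (j, inord (index x (block j))).
  move=> xj xr; rewrite /key; case: pickP => [i /andP[xi _]|/(_ j)]; last by rewrite xj xr.
  by rewrite (glued_block_unique Y_disj xi xj).
have keyK : ocancel key unkey.
  move=> x; rewrite /key; case: pickP => //= j /andP[xj xr].
  rewrite /unkey /= inordK ?nth_index ?in_block ?xj //.
  by rewrite -(size_block j) index_mem in_block xj.
have unkeyK : pcancel unkey key.
  move=> [j k]; have kb : k < size (block j) by rewrite size_block.
  have : unkey (j, k) \in block j by apply: mem_nth.
  rewrite in_block => /andP[ej er]; rewrite (keyE _ j) //; congr (Some (_, _)).
  by apply: val_inj; rewrite /= inordK index_uniq ?enum_uniq.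
(* [pmap] drops the vertices outside [rest]; consecutive vertices of [rest] stay consecutive. *)
have [|p|phi phiP] := @path_plus_triangles _ (pmap key h).
- exact: pmap_uniq keyK _ uh.
- by rewrite (can2_mem_pmap keyK unkeyK).
pose c x := if key x is Some p then phi p.1 p.2 else ord0.
exists c => u v; rewrite !inE => /existsP[j /andP[uj ur]] /existsP[i /andP[vi vr]].
have ku := keyE u j uj ur; have kv := keyE v i vi vr.
case/orP=> [uv|/andP[uv /existsP[k /andP[uk vk]]]].
  have adjacent a b h1 h2 ka kb : h = h1 ++ a :: b :: h2 -> key a = Some ka ->
      key b = Some kb -> phi ka.1 ka.2 != phi kb.1 kb.2.
    move=> eh ea eb; move: phiP; rewrite eh pmap_cat /= ea /= eb /=.
    by rewrite sorted_cat_cons /= => /andP[_ /andP[]].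
  have e'uv : e' u v.
    by rewrite /e' uv /= !inE; apply/andP; split; apply/existsP; [exists j|exists i]; apply/andP.
  rewrite /c ku kv; have [h1 [h2 [eh|eh]]] := adj u v e'uv.
    exact: adjacent eh ku kv.
  by rewrite eq_sym; apply: adjacent eh kv ku.
rewrite /c ku kv /=.
have ej := glued_block_unique Y_disj uj uk; have ei := glued_block_unique Y_disj vi vk.
rewrite ej ei; rewrite (inj_eq perm_inj); apply: contra uv => /eqP ek.
by have := keyK v; have := keyK u; rewrite ku kv /= ej ei ek => -> /eqP.
Qed.

End RemoveTransversal.

Lemma exists_independent_hitting_transversal : #|triangles e| <= 3 ->
  exists t : 'I_q -> T, [/\ forall j, t j \in Y j, forall i j, ~~ e (t i) (t j) &
    forall C, C \in inner_cycles -> exists j, t j \in C].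
Proof.
move=> tri; have [r [rY r_hits]] := exists_hitting_transversal tri.
have [c cP] := rest_three_colorable rY r_hits.
pose P (t : {ffun 'I_q -> T}) := [forall j, t j \in Y j] && [forall i, forall j, ~~ e (t i) (t j)].
(* Each block without its [r j] has one vertex of each colour, so the vertices of colour [ord0] form
   an independent transversal. *)
have [t0 t0P] : exists t, P t.
  have tP j : exists x, [/\ x \in Y j, x != r j & c x = ord0].
    pose A := Y j :\ r j.
    have A3 : #|A| = 3 by have := cardsD1 (r j) (Y j); rewrite rY Y_card add1n => -[].
    have Arest x : x \in A -> x \in rest r.
      by rewrite !inE => /andP[xr xj]; apply/existsP; exists j; rewrite xj.
    have cinj : {in A &, injective c}.
      move=> x y xA yA cxy; apply/eqP; apply: contraT => xy.
      have := cP x y (Arest x xA) (Arest y yA); rewrite cxy eqxx; apply.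
      rewrite /glue xy; apply/orP; right; apply/existsP; exists j.
      by move: xA yA; rewrite !inE => /andP[_ ->] /andP[_ ->].
    have : ord0 \in c @: A.
      have -> : c @: A = setT; last by rewrite inE.
      by apply/eqP; rewrite eqEcard subsetT cardsT card_ord card_in_imset // A3.
    by case/imsetP => x; rewrite !inE => /andP[xr xj] ->; exists x.
  have [t tP'] := fin_all_exists tP; exists [ffun j => t j]; apply/andP; split.
    by apply/forallP => j; rewrite ffunE; have [] := tP' j.
  apply/forallP => i; apply/forallP => j; rewrite !ffunE; apply/negP => eij.
  have tr k : t k \in rest r.
    by rewrite inE; apply/existsP; exists k; have [-> -> _] := tP' k.
  have := cP _ _ (tr i) (tr j); rewrite /glue eij => /(_ isT).
  by have [_ _ ->] := tP' i; have [_ _ ->] := tP' j; rewrite eqxx.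
(* Maximal agreement with [r] forces [t] to hit every inner cycle, as a missed one would allow an
   exchange that increases it. *)
case: (arg_maxnP (fun t : {ffun 'I_q -> T} => #|[set j | t j == r j]|) t0P) => t.
case/andP=> /forallP tY /forallP tind tmax.
exists t; split=> // [i j|C CC]; first exact: (forallP (tind i)).
have [j0 rj0] := r_hits C CC.
case: (boolP [exists j, t j \in C]) => [/existsP //|/existsPn tC].
(* An independent transversal missing [C] stays independent when its vertex in
   block [j0] is replaced by [r j0], all neighbours of which lie on [C]. *)
have ind_r j : ~~ e (r j0) (t j).
  by apply: contra (tC j) => /(inner_cycle_closed CC rj0).
pose t' : {ffun 'I_q -> T} := [ffun j => if j == j0 then r j0 else t j].
have Pt' : P t'.
  apply/andP; split; apply/forallP => i; first by rewrite ffunE; case: eqP => [->|].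
  apply/forallP => j; rewrite !ffunE; case: eqP => _; case: eqP => _ //.
  - by rewrite e_irr.
  - by rewrite e_sym.
  - exact: (forallP (tind i)).
suff : #|[set j | t j == r j]| < #|[set j | t' j == r j]|.
  by rewrite ltnNge; have /= -> := tmax t' Pt'.
apply: proper_card; rewrite properE; apply/andP; split.
  by apply/subsetP => j; rewrite !inE ffunE; case: (eqVneq j j0) => [->|].
apply/subsetPn; exists j0; rewrite !inE ?ffunE ?eqxx //.
by apply: contra (tC j0) => /eqP->.
Qed.

Theorem colorable_few_triangles : #|triangles e| <= 3 -> colorable (glue e Y) 4.
Proof.
move=> tri; have [t [tY tind t_hits]] := exists_independent_hitting_transversal tri.
have [c cP] := rest_three_colorable tY t_hits.
(* The independent transversal [t] receives the fourth colour. *)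
pose f x : 'I_4 := if x \in rest t then widen_ord (isT : 3 <= 4) (c x) else ord_max.
have g_sym : symmetric (glue e Y).
  move=> x y; rewrite /glue e_sym eq_sym; congr (_ || (_ && _)).
  by apply: eq_existsb => j; rewrite andbC.
have g_irr : irreflexive (glue e Y) by move=> x; rewrite /glue e_irr eqxx.
have in_block x : x \in \bigcup_j Y j -> x \notin rest t -> exists2 j, x \in Y j & x = t j.
  case/bigcupP => j _ xj; rewrite inE => /existsPn /(_ j); rewrite xj negbK => /eqP ->.
  by exists j.
apply: (colorable_extend (X := \bigcup_j Y j) (f := f) g_sym g_irr).
- have lt_max (i : 'I_3) : widen_ord (isT : 3 <= 4) i != ord_max.
    by rewrite -val_eqE /= neq_ltn ltn_ord.
  move=> u v uU vU uv; rewrite /f.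
  case: (boolP (u \in rest t)) => ur; case: (boolP (v \in rest t)) => vr.
  + by rewrite -val_eqE; apply: cP.
  + exact: lt_max.
  + by rewrite eq_sym.
  have [i ui ut] := in_block u uU ur; have [j vj vt] := in_block v vU vr.
  move: uv; rewrite /glue ut vt (negbTE (tind i j)) /= => /andP[tij /existsP[k /andP[ik jk]]].
  have ek := glued_block_unique Y_disj (tY i) ik.
  by rewrite ek (glued_block_unique Y_disj (tY j) jk) eqxx in tij.
(* A vertex outside the blocks has only its neighbours in [e], at most two. *)
move=> x xU; rewrite ltnS ltnW // ltnS; apply: leq_trans (e_deg x).
apply/subset_leq_card/subsetP => y; rewrite !inE => /orP[//|/andP[_ /existsP[j /andP[xj _]]]].
by case/negP: xU; apply/bigcupP; exists j.
Qed.

End FewTriangles.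

Theorem theorem1p2 (T : finType) (e : rel T) (q : nat) (Y : 'I_q -> {set T}) :
  simple_graph e ->
  max_deg_le e 2 ->
  (forall j, #|Y j| = 4) ->
  (forall i j, i != j -> [disjoint Y i & Y j]) ->
  (at_most_one_long_odd_cycle e \/ #|triangles e| <= 3) ->
  colorable (glue e Y) 4.
Proof.
move=> [e_sym e_irr] e_deg Y_card Y_disj [one|few].
  exact: colorable_one_long_odd_cycle.
exact: colorable_few_triangles.
Qed.
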